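(* There exist an absolute constant $c_1>0$, constants $c_0(\alpha,q)$ depending only on $\alpha$ and $q$, and constants $c_2(q)>0$ depending only on $q$, such that the following holds. Let $1\le q<2$, let $\xi$ be a standard $q$-stable random variable, let $\xi_1,\dots,\xi_n$ be independent copies of $\xi$, and set $X=(\xi_i)_{i=1}^n$. Let $0<\alpha<1$, $N\ge c_0(\alpha,q)\,n$, and let $X_1,\dots,X_N$ be independent copies of $X$. Then with probability at least $1-2\exp(-c_1N^{1-\alpha}n^\alpha)$, $$\mathrm{absconv}(X_1,\dots,X_N)\supset c_2(q)\left(\frac Nn\right)^{\alpha/q}B_{q'}^n,$$ where $1/q+1/q'=1$. In particular, if $\xi$ is a standard Cauchy random variable (corresponding to $q=1$), then with probability at least $1-2\exp(-c_1N^{1-\alpha}n^\alpha)$, $$\mathrm{absconv}(X_1,\dots,X_N)\supset c_3\left(\frac Nn\right)^{\alpha}B_\infty^n,$$ where $c_3>0$ is an absolute constant.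
   Context: A real random variable $\xi$ is called standard $q$-stable (symmetric case) if its characteristic function satisfies $\mathbb{E}[\exp(it\xi)]=\exp(-|t|^q/2)$ for every $t\in\mathbb{R}$. $\mathrm{absconv}(X_1,\dots,X_N)$ is the convex hull of $\pm X_1,\dots,\pm X_N$. $B_s^n$ is the closed unit ball of $\ell_s^n$ for $1\le s\le\infty$. *)

(* Defs.v *)
From HB Require Import structures.
From mathcomp Require Import all_boot all_order all_algebra.
From mathcomp Require Import complex.
From mathcomp Require Import all_classical all_reals all_analysis.

Set Implicit Arguments.
Unset Strict Implicit.
Unset Printing Implicit Defensive.

Import Order.TTheory GRing.Theory Num.Theory.
Import numFieldNormedType.Exports.

Local Open Scope classical_set_scope.
Local Open Scope ring_scope.

Section Probability.
Context {d : measure_display} {T : measurableType d} {R : realType}.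
Variable P : probability T R.

Definition char_fun (X : T -> R) (t : R) : R[i] :=
  Complex (fine 'E_P[fun w => cos (t * X w)])
          (fine 'E_P[fun w => sin (t * X w)]).

Definition standard_stable (q : R) (X : T -> R) : Prop :=
  forall t : R, char_fun X t = real_complex R (expR (- (`|t| `^ q / 2))).

Definition equal_in_law {d'} {T' : measurableType d'}
    (X Y : {mfun T >-> T'}) : Prop :=
  forall A : set T', measurable A -> distribution P X A = distribution P Y A.

Definition independent_RVs {d'} {T' : measurableType d'} (I : finType)
    (X : I -> {mfun T >-> T'}) : Prop :=
  forall (J : {set I}) (A : I -> set T'),
    (forall i, i \in J -> measurable (A i)) ->
    P (\bigcap_(i in [set` J]) (X i @^-1` A i)) =
      (\prod_(i in J) P (X i @^-1` A i))%E.

Definition independent_copies {d'} {T' : measurableType d'} (I : finType)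
    (Y : {mfun T >-> T'}) (X : I -> {mfun T >-> T'}) : Prop :=
  independent_RVs X /\ forall i, equal_in_law (X i) Y.

End Probability.

Section RandomVector.
Context {d : measure_display} {T : measurableType d} {R : realType}.
Context {n : nat}.
Variable xs : 'I_n -> {mfun T >-> R}.

(* The sigma-algebra on n.-tuple R is the one generated by the coordinates,
   that is, the Borel sigma-algebra of R^n. *)
Definition random_vector (w : T) : n.-tuple R := [tuple xs i w | i < n].

Lemma measurable_random_vector : measurable_fun [set: T] random_vector.
Proof.
apply/measurable_fun_tnthP => i.
rewrite (_ : _ \o _ = xs i); first exact: measurable_funPT.
by apply/funext => w /=; rewrite tnth_mktuple.
Qed.

HB.instance Definition _ :=
  isMeasurableFun.Build _ _ _ _ random_vector measurable_random_vector.

End RandomVector.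

Section Geometry.
Context {R : realType}.

Definition row_of_tuple {n} (t : n.-tuple R) : 'rV[R]_n := \row_i tnth t i.

(* Only 1 <= s <= +oo is meaningful; the value at s = -oo is junk. *)
Definition lnorm {n} (s : \bar R) (x : 'rV[R]_n) : R :=
  match s with
  | r%:E => (\sum_(i < n) `|x ord0 i| `^ r) `^ r^-1
  | +oo%E => \big[Num.max/0]_(i < n) `|x ord0 i|
  | -oo%E => 0
  end.

Definition lball (n : nat) (s : \bar R) : set 'rV[R]_n :=
  [set x | lnorm s x <= 1].

Definition scale_set {n} (c : R) (A : set 'rV[R]_n) : set 'rV[R]_n :=
  [set c *: x | x in A].

Definition convex_hull {n} (A : set 'rV[R]_n) : set 'rV[R]_n :=
  smallest (@convex_set R 'rV[R]_n) A.

Definition absconv {n N} (v : 'I_N -> 'rV[R]_n) : set 'rV[R]_n :=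
  convex_hull (range v `|` range (fun j => - v j)).

End Geometry.

Arguments lball {R} n s.

(* Main.v *)
(** Duality turns the inclusion into: no direction y satisfies
    |<X_j, y>| < r |y|_q for all j.  Fix such a y.  Since the missed
    directions form a polytope (made bounded by adding the harmless rows
    (r/2) e_i) and |.|_q is a supremum of linear functionals, linear
    programming moves y to a vertex, which is determined up to a scalar by a
    set S of at most n rows and by signs.  Conditionally on the rows in S, the
    other N - n rows miss this fixed direction independently.  By stability
    <X, y> has the characteristic function of |y|_q xi, whence
    P(|<X, y>| > r |y|_q) >= c(q) r^-q, and the union bound over the at most
    (C N / n)^n choices of S and signs concludes. *)

Require Import Defs.
From HB Require Import structures.
From mathcomp Require Import all_boot all_order all_algebra.
From mathcomp Require Import complex.
From mathcomp Require Import all_classical all_reals all_analysis.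
From mathcomp Require Import measurable_realfun ring lra.

Set Implicit Arguments.
Unset Strict Implicit.
Unset Printing Implicit Defensive.

Import Order.TTheory GRing.Theory Num.Theory.
Import numFieldNormedType.Exports.

Local Open Scope classical_set_scope.
Local Open Scope ring_scope.

(** * Dual norms *)

Arguments lnorm : simpl never.

Section DualNorms.
Context {R : realType}.
Implicit Type q : R.

(** A net of directions would need upper bounds on the rows, whose entries have heavy tails for q <
    2. Passing to vertices removes that need: the candidate directions form a finite, though random,
    family, and only a lower bound on P(|<X, y>| > r |y|_q) enters. Randomness of the candidates is
    handled by writing each one, for given active set S and sign pattern Q, as an explicit
    polynomial in the rows of S. This makes it measurable, and constant once those rows are frozen,
    so that conditioning becomes Fubini for the joint law of two complementary blocks. The radius is
    chosen to make the hitting probability of one row at least 4 (n/N)^alpha. The at least N/2 free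
    rows then all miss with probability at most exp(-2 N^(1-alpha) n^alpha), and half of this
    exponent pays for the union over (S, Q): the logarithm of the count is of order n log(N/n),
    which is below N^(1-alpha) n^alpha = n (N/n)^(1-alpha) once N/n is large in terms of alpha. *)

Definition dotp {n} (x y : 'rV[R]_n) : R := \sum_i x ord0 i * y ord0 i.

Lemma dotpC {n} (x y : 'rV[R]_n) : dotp x y = dotp y x.
Proof. by apply: eq_bigr => i _; rewrite mulrC. Qed.

Lemma dotpDl {n} (x y z : 'rV[R]_n) : dotp (x + y) z = dotp x z + dotp y z.
Proof.
by rewrite -big_split; apply: eq_bigr => i _; rewrite mxE mulrDl.
Qed.

Lemma dotpZl {n} a (x z : 'rV[R]_n) : dotp (a *: x) z = a * dotp x z.
Proof. by rewrite /dotp mulr_sumr; apply: eq_bigr => i _; rewrite mxE mulrA. Qed.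

Lemma dotpNl {n} (x z : 'rV[R]_n) : dotp (- x) z = - dotp x z.
Proof. by rewrite -scaleN1r dotpZl mulN1r. Qed.

Lemma dotpDr {n} (x y z : 'rV[R]_n) : dotp z (x + y) = dotp z x + dotp z y.
Proof. by rewrite ![dotp z _]dotpC dotpDl. Qed.

Lemma dotpZr {n} a (x z : 'rV[R]_n) : dotp z (a *: x) = a * dotp z x.
Proof. by rewrite ![dotp z _]dotpC dotpZl. Qed.

Lemma dotpNr {n} (x z : 'rV[R]_n) : dotp z (- x) = - dotp z x.
Proof. by rewrite ![dotp z _]dotpC dotpNl. Qed.

Lemma dotp0r {n} (z : 'rV[R]_n) : dotp z 0 = 0.
Proof. by rewrite -(scale0r 0) dotpZr mul0r. Qed.

Lemma dotp_ge0 {n} (x : 'rV[R]_n) : 0 <= dotp x x.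
Proof. by apply: sumr_ge0 => i _; rewrite -expr2 sqr_ge0. Qed.

Lemma dotp_eq0 {n} (x : 'rV[R]_n) : dotp x x <= 0 -> x = 0.
Proof.
move=> x0; have /eqP : dotp x x = 0 by apply/eqP; rewrite eq_le x0 dotp_ge0.
rewrite psumr_eq0 => [/allP h|i _]; last by rewrite -expr2 sqr_ge0.
apply/rowP => i; rewrite mxE; apply/eqP.
by have := h i (mem_index_enum _); rewrite mulf_eq0 orbb.
Qed.

Lemma dotp_mulmx {n} (x y : 'rV[R]_n) : dotp x y = (x *m y^T) ord0 ord0.
Proof. by rewrite mxE; apply: eq_bigr => i _; rewrite mxE. Qed.

(** In the extended reals 0 and -oo have inverses +oo and -oo, which cannot solve the equation; a
    finite q' must be positive because q^-1 < 1. *)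
Lemma conjugate_exponents q (q' : \bar R) : 1 <= q -> (q%:E^-1 + q'^-1 = 1)%E ->
  (q = 1 /\ q' = +oo%E) \/
  [/\ 1 < q & exists2 p : R, q' = p%:E & 0 < p /\ q^-1 + p^-1 = 1].
Proof.
move=> q1; have q0 : 0 < q by exact: lt_le_trans q1.
have iq : q^-1 <= 1 by rewrite invf_le1.
rewrite inver gt_eqF//; case: (inveP q') => [|||p p0].
- by rewrite addey// => /eqP.
- by rewrite adde0 => -[/eqP]; rewrite invr_eq1 => /eqP ->; left.
- by rewrite addeNy// => /eqP.
rewrite -EFinD => -[pq]; right.
have q1' : q != 1.
  apply: contra_eq_neq pq => ->; rewrite invr1 -subr_eq0 addrAC subrr add0r.
  by rewrite invr_eq0.
have lq1 : 1 < q by rewrite lt_neqAle eq_sym q1' q1.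
split => //; exists p => //; split => //; rewrite -invr_gt0.
have : q^-1 < 1 by rewrite invf_lt1.
lra.
Qed.

Lemma one_powR a : 1 `^ a = 1 :> R.
Proof. by rewrite powR1. Qed.

Lemma lnormE {n} q (x : 'rV[R]_n) :
  lnorm q%:E x = (\sum_(i < n) `|x ord0 i| `^ q) `^ q^-1.
Proof. by []. Qed.

Lemma lnorm_ge0 {n} q (x : 'rV[R]_n) : 0 <= lnorm q%:E x.
Proof. exact: powR_ge0. Qed.

Lemma lnorm_powR {n} q (x : 'rV[R]_n) : 0 < q ->
  lnorm q%:E x `^ q = \sum_(i < n) `|x ord0 i| `^ q.
Proof.
move=> q0; rewrite lnormE -powRrM mulVf ?gt_eqF// powRr1//.
by apply: sumr_ge0 => i _; exact: powR_ge0.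
Qed.

Lemma lnormZ {n} q a (x : 'rV[R]_n) : 0 < q ->
  lnorm q%:E (a *: x) = `|a| * lnorm q%:E x.
Proof.
move=> q0; rewrite !lnormE.
under eq_bigr do rewrite mxE normrM powRM//.
rewrite -mulr_sumr powRM//; last first.
  by apply: sumr_ge0 => i _; exact: powR_ge0.
by rewrite -powRrM divff ?gt_eqF// powRr1.
Qed.

Lemma lnorm0 {n} q : 0 < q -> lnorm q%:E (0 : 'rV[R]_n) = 0.
Proof. by move=> q0; rewrite -(scale0r (0 : 'rV[R]_n)) lnormZ// normr0 mul0r. Qed.

Lemma ler_coord_lnorm {n} q (x : 'rV[R]_n) i : 0 < q ->
  `|x ord0 i| <= lnorm q%:E x.
Proof.
move=> q0.
rewrite -[leLHS]powRr1// -(divff (lt0r_neq0 q0)) powRrM lnormE.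
apply: ge0_ler_powR; rewrite ?nnegrE ?invr_ge0 ?(ltW q0)//.
  by apply: sumr_ge0 => j _; exact: powR_ge0.
by rewrite (bigD1 i)//= lerDl; apply: sumr_ge0 => j _; exact: powR_ge0.
Qed.

Lemma lnorm_eq0 {n} q (x : 'rV[R]_n) : 0 < q -> lnorm q%:E x = 0 -> x = 0.
Proof.
move=> q0 x0; apply/rowP => i; rewrite mxE; apply/eqP.
by rewrite -normr_le0 -x0 ler_coord_lnorm.
Qed.

Lemma lnorm1E {n} (x : 'rV[R]_n) : lnorm 1%:E x = \sum_i `|x ord0 i|.
Proof.
rewrite lnormE invr1 powRr1; last by apply: sumr_ge0 => i _; exact: powR_ge0.
by apply: eq_bigr => i _; rewrite powRr1.
Qed.

(** For q > 1, after y is scaled to norm 1, Young's inequality in each coordinate sums to at most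
    1/p + 1/q = 1. *)
Lemma lnorm_hoelder {n} q (q' : \bar R) (x y : 'rV[R]_n) :
  1 <= q -> (q%:E^-1 + q'^-1 = 1)%E -> lnorm q' x <= 1 ->
  dotp x y <= lnorm q%:E y.
Proof.
move=> q1 /(conjugate_exponents q1)[[-> ->] x1|[{}q1 [p -> [p0 pq]] x1]].
  rewrite lnorm1E; apply: ler_sum => i _; apply: le_trans (ler_norm _) _.
  rewrite normrM ler_piMl//; apply: le_trans x1.
  exact: (le_bigmax _ (fun i => `|x ord0 i|)).
have q0 : 0 < q by exact: lt_trans q1.
have [/lnorm_eq0 -> //|s0] := eqVneq (lnorm q%:E y) 0.
  by rewrite dotp0r lnorm_ge0.
set s := lnorm _ _ in s0 *; have {}s0 : 0 < s by rewrite lt_def s0 lnorm_ge0.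
rewrite -[leRHS]mul1r -ler_pdivrMr// mulrC -dotpZr.
have x1' : \sum_i `|x ord0 i| `^ p <= 1.
  rewrite -lnorm_powR// -[leRHS](one_powR p).
  by rewrite ge0_ler_powR ?nnegrE ?lnorm_ge0 ?(ltW p0).
have y1 : \sum_i `|(s^-1 *: y) ord0 i| `^ q = 1.
  by rewrite -lnorm_powR// lnormZ// gtr0_norm ?invr_gt0// mulVf ?gt_eqF// powR1.
apply: (@le_trans _ _
  (\sum_i (`|x ord0 i| `^ p / p + `|(s^-1 *: y) ord0 i| `^ q / q))).
  apply: ler_sum => i _; apply: le_trans (ler_norm _) _; rewrite normrM.
  by apply: conjugate_powR => //; rewrite addrC.
rewrite big_split/= -!mulr_suml y1 mul1r -pq addrC lerD2l ler_piMl//.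
by rewrite invr_ge0 ltW.
Qed.

(** Equality case of Hölder. As the supremum is attained, the norm at y is the value of one linear
    functional, which can serve as the objective of a linear program: any point where it is larger
    has a larger norm. *)
Lemma lnorm_norming {n} q (q' : \bar R) (y : 'rV[R]_n) :
  1 <= q -> (q%:E^-1 + q'^-1 = 1)%E ->
  exists2 x : 'rV[R]_n, lnorm q' x <= 1 & dotp x y = lnorm q%:E y.
Proof.
move=> q1 /(conjugate_exponents q1)[[-> ->]|[{}q1 [p -> [p0 pq]]]].
  exists (\row_i Num.sg (y ord0 i)).
    apply/bigmax_leP; split => // i _.
    by rewrite mxE normr_sg; case: (_ == _).
  by rewrite lnorm1E; apply: eq_bigr => i _; rewrite mxE -normrEsg.
have q0 : 0 < q by exact: lt_trans q1.
have [y0|s0] := eqVneq (lnorm q%:E y) 0.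
  exists 0; last by rewrite y0 dotpC dotp0r.
  rewrite lnormE big1 ?powR0 ?invr_neq0 ?gt_eqF// => i _.
  by rewrite mxE normr0 powR0 ?gt_eqF.
set s := lnorm _ _ in s0 *; have {}s0 : 0 < s by rewrite lt_def s0 lnorm_ge0.
have sq : s `^ q = s `^ (q - 1) * s.
  by rewrite mulrC mulr_powRB1// ltW.
have sq1 : 0 < s `^ (q - 1) by exact: powR_gt0.
have qp : (q - 1) * p = q.
  have -> : q - 1 = q * (1 - q^-1) by rewrite mulrBr mulr1 divff ?gt_eqF.
  by rewrite -pq [_ + p^-1]addrC addrK mulfVK// gt_eqF.
(* The gradient of |.|_q at y; the relation (q - 1) p = q turns its p-th powers into |y_i|^q /
   s^q. *)
exists (\row_i (Num.sg (y ord0 i) * `|y ord0 i| `^ (q - 1) / s `^ (q - 1))).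
  rewrite lnormE -[leRHS](one_powR p^-1).
  apply: ge0_ler_powR; rewrite ?nnegrE ?invr_ge0 ?(ltW p0)//.
    by apply: sumr_ge0 => i _; exact: powR_ge0.
  apply: (@le_trans _ _ (\sum_i (`|y ord0 i| `^ q / s `^ q))); last first.
    by rewrite -mulr_suml -lnorm_powR// -/s divff// gt_eqF// powR_gt0.
  apply: ler_sum => i _; rewrite mxE normrM normrM normr_sg.
  rewrite [`|_^-1|]gtr0_norm ?invr_gt0// [`|_ `^ _|]ger0_norm ?powR_ge0//.
  have [->|y0] := eqVneq (y ord0 i) 0.
    by rewrite mul0r mul0r powR0 ?gt_eqF// normr0 powR0 ?gt_eqF// mul0r.
  rewrite mul1r powRM ?invr_ge0 ?powR_ge0// -powRrM qp.
  by rewrite -(powR_inv1 (powR_ge0 s (q - 1))) -powRrM mulN1r powRN -powRrM qp.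
rewrite -[RHS](mulfVK (lt0r_neq0 sq1)) -mulrA [_ ^-1 * _]mulrC mulrA.
rewrite [s * _]mulrC -sq lnorm_powR// mulr_suml; apply: eq_bigr => i _.
rewrite mxE mulrAC; congr (_ / _).
by rewrite mulrAC -normrEsg mulr_powRB1.
Qed.
End DualNorms.

(** * Absolute convex hulls *)

Section AbsoluteConvexHull.
Local Open Scope convex_scope.
Context {R : realType} {n : nat}.

Lemma convex_set_comb (C : set 'rV[R]_n) : convex_set C ->
  forall x y t, C x -> C y -> 0 <= t <= 1 -> C (t *: x + (1 - t) *: y).
Proof.
move=> cC x y t Cx Cy /andP[t0 t1].
have /set_mem := cC x y (Itv01 t0 t1) (mem_set Cx) (mem_set Cy).
by [].
Qed.

Lemma convex_set_subcomb (C : set 'rV[R]_n) : convex_set C -> C 0 ->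
  forall N (w : 'I_N -> R) (z : 'I_N -> 'rV[R]_n),
    (forall j, 0 <= w j) -> \sum_j w j <= 1 -> (forall j, C (z j)) ->
  C (\sum_j w j *: z j).
Proof.
move=> cC C0; elim => [|N IH] w z w0 w1 Cz; first by rewrite big_ord0.
rewrite big_ord_recl; rewrite big_ord_recl in w1.
set w' := w ord0 in w1 *.
have s0 : 0 <= \sum_(i < N) w (lift ord0 i) by apply: sumr_ge0 => i _; exact: w0.
have w'0 : 0 <= w' by exact: w0.
have [e|ne] := eqVneq w' 1.
  rewrite big1 => [|i _]; first by rewrite addr0 e scale1r; exact: Cz.
  have /psumr_eq0P h : \sum_(i < N) w (lift ord0 i) = 0 by lra.
  by rewrite h ?scale0r// => j _; exact: w0.
have w'1 : 0 < 1 - w' by rewrite subr_gt0 lt_neqAle ne/=; lra.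
rewrite (_ : \sum_(i < N) _ = (1 - w') *: \sum_(i < N)
    (w (lift ord0 i) / (1 - w')) *: z (lift ord0 i)); last first.
  rewrite scaler_sumr; apply: eq_bigr => i _.
  by rewrite scalerA mulrCA divff ?gt_eqF// mulr1.
apply: convex_set_comb => //; last by apply/andP; split => //; lra.
apply: IH => [j||j].
- by rewrite divr_ge0// ltW.
- by rewrite -mulr_suml ler_pdivrMr// mul1r; lra.
- exact: Cz.
Qed.

(** Each a_j v_j is |a_j| times one of 0, v_j, -v_j. At least one row is required to put 0 in the
    hull, the hull of an empty family being empty. *)
Lemma absconv_comb N (v : 'I_N -> 'rV[R]_n) (a : 'I_N -> R) : (0 < N)%N ->
  \sum_j `|a j| <= 1 -> absconv v (\sum_j a j *: v j).
Proof.
case: N v a => // N v a _ a1 C [cC vC].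
have Cv j : C (v j) by apply: vC; left; exists j.
have CNv j : C (- v j) by apply: vC; right; exists j.
have C0 : C 0.
  rewrite (_ : 0 = 2^-1 *: v ord0 + (1 - 2^-1) *: - v ord0); last first.
    by rewrite scalerN -scalerBl (_ : _ - _ = 0) ?scale0r//; field.
  by apply: convex_set_comb => //; apply/andP; split; lra.
under eq_bigr do rewrite (numEsg (a _)) mulrC -scalerA.
apply: convex_set_subcomb => // j; case: sgrP => _.
- by rewrite scale0r.
- by rewrite scale1r.
- by rewrite scaleN1r.
Qed.

(** The half-space of all z with <z, y> <= max_j |<v_j, y>| is convex and contains every v_j and
    -v_j, hence the hull. *)
Lemma absconv_dotp N (v : 'I_N -> 'rV[R]_n) (x y : 'rV[R]_n) : (0 < N)%N ->
  absconv v x -> exists j, dotp x y <= `|dotp (v j) y|.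
Proof.
case: N v => // N v _ vx.
have [j jmax] : exists j, forall i, `|dotp (v i) y| <= `|dotp (v j) y|.
  case: (Order.TotalTheory.arg_maxP (fun j => `|dotp (v j) y|)
    (isT : predT (ord0 : 'I_N.+1))) => j _ jmax.
  by exists j => i; exact: jmax.
exists j; apply: (vx [set z | dotp z y <= `|dotp (v j) y|]); split => /=.
  move=> a b t /set_mem/= az /set_mem/= bz; apply/mem_set => /=.
  have [t0 t1] : 0 <= t%:num /\ t%:num <= 1 by [].
  rewrite -[a <| t |> b]/(t%:num *: a + (1 - t%:num) *: b).
  by rewrite dotpDl !dotpZl; nra.
move=> _ [[i _ <-]|[i _ <-]] /=.
  exact: le_trans (ler_norm _) (jmax i).
by rewrite dotpNl; apply: le_trans (jmax i); rewrite -normrN ler_norm.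
Qed.

Lemma continuous_sum (T : topologicalType) (I : Type) (r : seq I)
    (f : I -> T -> R) :
  (forall i, continuous (f i)) -> continuous (fun x => \sum_(i <- r) f i x).
Proof.
move=> cf; apply: continuous_big => // x.
exact: add_continuous.
Qed.

Lemma compact_l1_ball N : compact [set a : 'rV[R]_N | \sum_j `|a ord0 j| <= 1].
Proof.
have cb : compact [set v : 'rV[R]_N | forall i, v ord0 i \in `[-1, 1]].
  apply: (@rV_compact _ _ (fun=> `[(-1 : R), 1]%classic)) => _.
  exact: segment_compact.
apply: subclosed_compact cb _ => [|a /= a1 i]; last first.
  rewrite in_itv/= -ler_norml; apply: le_trans a1.
  by rewrite (bigD1 i)//= lerDl sumr_ge0.
rewrite (_ : mkset _ =
    (fun a : 'rV[R]_N => \sum_j `|a ord0 j|) @^-1` `]-oo, 1]%classic); last first.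
  by apply/seteqP; split=> a/=; rewrite in_itv.
apply: preimage_closed; last exact: interval_closed.
move=> b _; apply: continuous_sum => j a.
by apply: (@continuous_comp _ _ _ (fun a : 'rV[R]_N => a ord0 j) (@Num.norm _ R));
  [exact: coord_continuous|exact: norm_continuous].
Qed.

Lemma dotp_subZ (y w : 'rV[R]_n) t :
  dotp (y - t *: w) (y - t *: w) = dotp y y - 2 * t * dotp w y + t ^+ 2 * dotp w w.
Proof.
by rewrite !(dotpDl, dotpDr, dotpNl, dotpNr, dotpZl, dotpZr) (dotpC y w); ring.
Qed.

(* Project x onto the hull: the residual y = x - proj separates. *)
Lemma l1_comb_separation N (v : 'I_N -> 'rV[R]_n) (x : 'rV[R]_n) :
  (forall y, exists j, dotp x y <= `|dotp (v j) y|) ->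
  exists2 a : 'rV[R]_N, \sum_j `|a ord0 j| <= 1 & x = \sum_j a ord0 j *: v j.
Proof.
move=> hx.
pose L (a : 'rV[R]_N) := \sum_j a ord0 j *: v j.
have LD a b t : L (a + t *: (b - a)) = L a + t *: (L b - L a).
  rewrite /L -sumrB scaler_sumr -big_split/=; apply: eq_bigr => j _.
  by rewrite !mxE scalerDl -scalerA -scalerBl.
pose f a := dotp (x - L a) (x - L a).
have cf : continuous f.
  apply: continuous_sum => i a.
  have cL : continuous (fun b => (x - L b) ord0 i); last first.
    exact: (cvgM (cL a) (cL a)).
  rewrite (_ : (fun b => (x - L b) ord0 i) =
      fun b : 'rV[R]_N => x ord0 i - \sum_j b ord0 j * v j ord0 i); last first.
    apply/funext => b; rewrite !mxE summxE; congr (_ - _).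
    by apply: eq_bigr => j _; rewrite mxE.
  have cS : continuous (fun b : 'rV[R]_N => \sum_j b ord0 j * v j ord0 i).
    apply: continuous_sum => j b.
    exact: (cvgM (@coord_continuous _ _ _ ord0 j b) (cvg_cst (v j ord0 i))).
  by move=> {}a; exact: (cvgB (cvg_cst (x ord0 i)) (cS a)).
have A0 : [set a : 'rV[R]_N | \sum_j `|a ord0 j| <= 1] !=set0.
  by exists 0 => /=; rewrite big1// => i _; rewrite mxE normr0.
(* Minimising over coefficients rather than over points of the hull makes the domain a compact l1
   ball. *)
have [a /set_mem/= a1 amin] := EVT_min_rV A0 (@compact_l1_ball N)
  (continuous_subspaceT cf).
exists a => //; set y := x - L a.
have amin' (b : 'rV[R]_N) : \sum_j `|b ord0 j| <= 1 -> dotp (L b) y <= dotp (L a) y.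
  move=> b1; set w := L b - L a.
  suff : dotp w y <= 0 by rewrite dotpDl dotpNl subr_le0.
  rewrite leNgt; apply/negP => wy.
  have w0 := dotp_ge0 w.
  have s0 : 0 < dotp w y + dotp w w by rewrite ltr_wpDr.
  have [t [t0 t1 te]] :
      (* With this t, moving from a towards b changes the squared distance by -t (1 + t) <w, y> < 0,
         against minimality. The summand <w, y> in the denominator keeps t <= 1. *)
      exists t, [/\ 0 < t, t <= 1 & t * (dotp w y + dotp w w) = dotp w y].
    exists (dotp w y / (dotp w y + dotp w w)); split.
    - by rewrite divr_gt0.
    - by rewrite ler_pdivrMr// mul1r lerDl.
    - by rewrite mulfVK// gt_eqF.
  have cb : \sum_j `|(a + t *: (b - a)) ord0 j| <= 1.
    apply: (@le_trans _ _ (\sum_j ((1 - t) * `|a ord0 j| + t * `|b ord0 j|))).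
      apply: ler_sum => j _; rewrite !mxE.
      have -> : a ord0 j + t * (b ord0 j - a ord0 j) =
          (1 - t) * a ord0 j + t * b ord0 j by ring.
      apply: le_trans (ler_normD _ _) _; rewrite !normrM.
            by rewrite (@ger0_norm _ t) ?(@ger0_norm _ (1 - t))//; lra.
    by rewrite big_split/= -!mulr_sumr; nra.
  have /amin : (a + t *: (b - a)) \in [set a : 'rV[R]_N | \sum_j `|a ord0 j| <= 1].
    exact/mem_set.
  rewrite /f LD -/w (_ : x - (L a + _) = y - t *: w); last first.
    by rewrite opprD addrA.
  by rewrite -/y dotp_subZ; nra.
(* The hypothesis at the residual y, with minimality tested at v_j and -v_j, gives <x, y> <= <L a,
   y>, that is <y, y> <= 0. *)
have [j xj] := hx y.
suff : dotp y y <= 0 by move/dotp_eq0/eqP; rewrite subr_eq0 => /eqP.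
rewrite {1}/y dotpDl dotpNl subr_le0; apply: le_trans xj _.
have Le (s : R) : `|s| <= 1 -> s * dotp (v j) y <= dotp (L a) y.
  move=> s1; rewrite -dotpZl (_ : s *: v j = L (s *: delta_mx ord0 j)).
    apply: amin'; rewrite (bigD1 j)//= big1 ?addr0 => [|i ij].
      by rewrite !mxE !eqxx mulr1.
    by rewrite !mxE (negbTE ij) andbF mulr0 normr0.
  rewrite /L (bigD1 j)//= big1 ?addr0 => [|i ij].
    by rewrite !mxE !eqxx mulr1.
  by rewrite !mxE (negbTE ij) andbF mulr0 scale0r.
rewrite ler_norml lerNl; apply/andP; split.
  by rewrite -mulN1r Le// normrN1.
by rewrite -[leLHS]mul1r Le// normr1.
Qed.

End AbsoluteConvexHull.

(** * Dual form of the inclusion, and its reduction to rational directions *)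

Section Duality.
Context {R : realType} {n : nat}.

Lemma scale_lball_sub_absconvP N (v : 'I_N -> 'rV[R]_n) (q : R) (q' : \bar R)
    (r : R) : (0 < N)%N -> 1 <= q -> (q%:E^-1 + q'^-1 = 1)%E -> 0 <= r ->
  scale_set r (lball n q') `<=` absconv v <->
  forall y, exists j, r * lnorm q%:E y <= `|dotp (v j) y|.
Proof.
move=> N0 q1 qq' r0; split => [sub y|h _ [x x1 <-]].
  have [x x1 <-] := lnorm_norming y q1 qq'.
  have [|j jx] := absconv_dotp y N0 (sub (r *: x) _); first by exists x.
  by exists j; rewrite -dotpZl.
have [y|a a1 ->] := @l1_comb_separation _ _ _ v (r *: x).
  have [j jx] := h y; exists j; rewrite dotpZl; apply: le_trans jx.
  by rewrite ler_wpM2l// (lnorm_hoelder _ q1 qq').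
exact: absconv_comb.
Qed.

Lemma dotp_le_sup (u z : 'rV[R]_n) (e : R) :
  (forall i, `|z ord0 i| <= e) -> `|dotp u z| <= e * \sum_i `|u ord0 i|.
Proof.
move=> ze; apply: le_trans (ler_norm_sum _ _ _) _; rewrite mulr_sumr.
by apply: ler_sum => i _; rewrite normrM mulrC ler_wpM2r.
Qed.

Lemma rat_row_dense (y : 'rV[R]_n) (e : R) : 0 < e ->
  exists z : 'rV[rat]_n, forall i, `|(map_mx ratr z - y) ord0 i| <= e.
Proof.
move=> e0; have h i : exists a : rat, `|ratr a - y ord0 i| <= e.
  have [|a] := @rat_in_itvoo R (y ord0 i - e) (y ord0 i + e); first by lra.
  by rewrite in_itv/= => ha; exists a; rewrite ler_norml; lra.
exists (\row_i sval (cid (h i))) => i.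
by rewrite !mxE; case: cid.
Qed.

(** Serves measurability: an uncountable intersection of events becomes a countable one. If y fails
    for every j, the finitely many strict inequalities have a common slack and survive a small move
    of y to a rational point, the norm being replaced by the functional that attains it at y. *)
Lemma all_rat_dualP N (v : 'I_N -> 'rV[R]_n) (q : R) (q' : \bar R) (r : R) :
  (0 < N)%N -> 1 <= q -> (q%:E^-1 + q'^-1 = 1)%E -> 0 <= r ->
  (forall y, exists j, r * lnorm q%:E y <= `|dotp (v j) y|) <->
  (forall y : 'rV[rat]_n, exists j,
     r * lnorm q%:E (map_mx ratr y) <= `|dotp (v j) (map_mx ratr y)|).
Proof.
move=> N0 q1 qq' r0; split => [h y|h y]; first exact: h.
apply: contrapT => /forallNP hy.
have {}hy j : `|dotp (v j) y| < r * lnorm q%:E y.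
  by rewrite ltNge; apply/negP; exact: hy.
have [x x1 xy] := lnorm_norming y q1 qq'; rewrite -xy in hy.
pose g j := r * dotp x y - `|dotp (v j) y|.
have [j0 jmin] : exists j0, forall j, g j0 <= g j.
  case: N N0 v h hy @g => // N _ v h hy g.
  case: (Order.TotalTheory.arg_minP g (isT : predT (ord0 : 'I_N.+1))) => j _ jm.
  by exists j => i; exact: jm.
have g0 : 0 < g j0 by rewrite subr_gt0.
(* K bounds the Lipschitz constant, in the sup norm, of every r <x, .> - |<v_j, .>|. *)
pose K := r * (\sum_i `|x ord0 i|) + \sum_j \sum_i `|v j ord0 i|.
have sx0 : 0 <= \sum_i `|x ord0 i| by exact: sumr_ge0.
have sv0 j : 0 <= \sum_i `|v j ord0 i| by exact: sumr_ge0.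
have K0 : 0 <= K by rewrite addr_ge0 ?mulr_ge0// sumr_ge0.
have [e e0 eK] : exists2 e, 0 < e & e * K < g j0.
  exists (g j0 / (1 + K)); first by rewrite divr_gt0// ltr_wpDr.
  by rewrite mulrAC ltr_pdivrMr ?ltr_wpDr// ltr_pM2l// ltrDr.
have [z zy] := rat_row_dense y e0.
have [j] := h z; apply/negP; rewrite -ltNge.
have zE : map_mx ratr z = y + (map_mx ratr z - y) by rewrite addrC subrK.
have xz : dotp x (map_mx ratr z) <= lnorm q%:E (map_mx ratr z).
  exact: (lnorm_hoelder _ q1 qq').
apply: lt_le_trans (ler_wpM2l r0 xz); rewrite zE !(dotpDr y).
have := dotp_le_sup (v j) zy; have := dotp_le_sup x zy.
move: (dotp x (_ - _)) (dotp (v j) (_ - _)) => a b.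
rewrite ler_norml => /andP[ha _] hb.
apply: le_lt_trans (ler_normD _ _) _; rewrite mulrDr.
have Kj : r * (\sum_i `|x ord0 i|) + \sum_i `|v j ord0 i| <= K.
  by rewrite lerD2l (bigD1 j)//= lerDl; apply: sumr_ge0 => i _; exact: sv0.
move: eK (ler_wpM2l (ltW e0) Kj) (ler_wpM2l r0 ha) (jmin j) hb; rewrite /g.
clear; move: (\sum_i `|x ord0 i|) (\sum_i `|v j ord0 i|) => A B.
by lra.
Qed.

End Duality.

(** * Vertices of polytopes *)

Section Vertices.
Context {R : realType}.

(** Rows outside S are zeroed, not deleted, so that all subsystems have the same shape and their
    ranks can be compared. *)
Definition maskmx {M n} (S : {set 'I_M}) (V : 'M[R]_(M, n)) : 'M[R]_(M, n) :=
  \matrix_(j, i) if j \in S then V j i else 0.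

Lemma row_maskmx {M n} (S : {set 'I_M}) (V : 'M[R]_(M, n)) j :
  row j (maskmx S V) = if j \in S then row j V else 0.
Proof. by apply/rowP => i; rewrite !mxE; case: ifP => _; rewrite mxE. Qed.

Lemma mulmx_trE {M n} (A : 'M[R]_(M, n)) (u : 'rV[R]_n) j :
  (A *m u^T) j ord0 = dotp (row j A) u.
Proof. by rewrite mxE; apply: eq_bigr => i _; rewrite !mxE. Qed.

(** The vector u is annihilated by the rows of S but not by row j, so row j is outside their
    span. *)
Lemma rank_maskmx_setU1 {M n} (S : {set 'I_M}) (V : 'M[R]_(M, n)) j
    (u : 'rV[R]_n) :
  (forall i, i \in S -> dotp (row i V) u = 0) -> dotp (row j V) u != 0 ->
  (\rank (maskmx S V) < \rank (maskmx (j |: S) V))%N.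
Proof.
move=> Su ju; suff : (maskmx S V < maskmx (j |: S) V)%MS.
  by rewrite ltmxErank => /andP[].
rewrite ltmxE; apply/andP; split.
  apply/row_subP => i; rewrite row_maskmx; case: ifP => iS; last exact: sub0mx.
  by rewrite (_ : row i V = row i (maskmx (j |: S) V)) ?row_sub// row_maskmx
    !inE iS orbT.
apply/negP => sub.
have /submxP[D DE] : (row j V <= maskmx S V)%MS.
  apply: submx_trans sub; rewrite (_ : row j V = row j (maskmx (j |: S) V)).
    exact: row_sub.
  by rewrite row_maskmx !inE eqxx.
have u0 : maskmx S V *m u^T = 0.
  apply/colP => i; rewrite mulmx_trE row_maskmx mxE; case: ifP => iS.
    exact: Su.
  by rewrite dotpC dotp0r.
by move/eqP: ju; apply; rewrite dotp_mulmx DE -mulmxA u0 mulmx0 mxE.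
Qed.

(* One pivot of the simplex method: move along u until a constraint on which
   u does not vanish becomes active. *)
Lemma lp_pivot {M n} (V : 'M[R]_(M, n)) (y u : 'rV[R]_n) (c : R) :
  (forall j, `|dotp (row j V) y| <= c) -> (exists j, dotp (row j V) u != 0) ->
  exists t j, [/\ 0 <= t, forall i, `|dotp (row i V) (y + t *: u)| <= c,
    `|dotp (row j V) (y + t *: u)| = c & dotp (row j V) u != 0].
Proof.
move=> yc [j1 j1u].
have c0 : 0 <= c by apply: le_trans (yc j1).
pose d j := dotp (row j V) u; pose e j := dotp (row j V) y.
(* The time at which row j reaches the value [Num.sg (d j) * c] along u; the pivot stops at the
   earliest one. *)
pose t j := (c - Num.sg (d j) * e j) / `|d j|.
case: (@Order.TotalTheory.arg_minP _ _ _ j1 (fun j => d j != 0) t j1u) => j dj tj.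
have t0 : 0 <= t j.
  rewrite divr_ge0// subr_ge0; apply: le_trans (ler_norm _) _.
  by rewrite normrM normr_sg dj mul1r yc.
exists (t j), j; split => // [i|]; rewrite dotpDr dotpZr -/(d _) -/(e _).
  have := yc i; rewrite -/(e i) !ler_norml => /andP[e1 e2].
  have [->|di] := eqVneq (d i) 0; first by rewrite mulr0 addr0 e1.
  have := tj i di; rewrite [t i]/t ler_pdivlMr ?normr_gt0//.
  by case: sgrP di => // di _; move: t0; nra.
rewrite /t; case: sgrP dj => // dj _.
  by rewrite mul1r mulfVK ?gt_eqF// addrC subrK ger0_norm.
rewrite invrN mulrN mulNr mulfVK ?lt_eqF//.
by rewrite mulN1r opprK opprD addrCA subrr addr0 normrN ger0_norm.
Qed.

(** The invariant that #|S| is at most the rank of the rows of S bounds S by n and makes the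
    pivoting stop. Each pivot direction annihilates the rows of S, so they stay active, and its sign
    is chosen so that <x, .> does not decrease. Injectivity of V ensures that some constraint is
    eventually met. *)
Lemma lp_vertex {M n} (V : 'M[R]_(M, n)) (x y : 'rV[R]_n) (c : R) :
  (forall u, (forall j, dotp (row j V) u = 0) -> u = 0) ->
  (forall j, `|dotp (row j V) y| <= c) ->
  exists (S : {set 'I_M}) z, [/\ (#|S| <= n)%N,
    forall j, `|dotp (row j V) z| <= c,
    forall j, j \in S -> `|dotp (row j V) z| = c,
    forall u, (forall j, j \in S -> dotp (row j V) u = 0) -> u = 0 &
    dotp x y <= dotp x z].
Proof.
move=> Vinj yc.
suff h k (S : {set 'I_M}) y' : (n - #|S| < k)%N ->
    (#|S| <= \rank (maskmx S V))%N ->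
    (forall j, `|dotp (row j V) y'| <= c) ->
    (forall j, j \in S -> `|dotp (row j V) y'| = c) -> dotp x y <= dotp x y' ->
    exists (S : {set 'I_M}) z, [/\ (#|S| <= n)%N,
      forall j, `|dotp (row j V) z| <= c,
      forall j, j \in S -> `|dotp (row j V) z| = c,
      forall u, (forall j, j \in S -> dotp (row j V) u = 0) -> u = 0 &
      dotp x y <= dotp x z].
  apply: (h n.+1 finset.set0 y) => //; rewrite ?cards0 ?subn0// => j.
  by rewrite inE.
elim: k S y' => // k IH S y' nk rS y'c Sc xy'.
have Sn : (#|S| <= n)%N by exact: leq_trans rS (rank_leq_col _).
have [Sinj|/existsNP[u0 /not_implyP[Su0 u00]]] := pselect
  (forall u, (forall j, j \in S -> dotp (row j V) u = 0) -> u = 0).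
  by exists S, y'.
have [u [Su u0' xu]] : exists u, [/\ forall j, j \in S -> dotp (row j V) u = 0,
    u <> 0 & 0 <= dotp x u].
  have [xu|xu] := leP 0 (dotp x u0); first by exists u0.
  exists (- u0); split; last by rewrite dotpNr oppr_ge0 ltW.
    by move=> j /Su0; rewrite dotpNr => ->; rewrite oppr0.
  by move/eqP; rewrite oppr_eq0 => /eqP.
have [|t [j [t0 tc tj ju]]] := @lp_pivot _ _ V y' u c y'c.
  apply: contrapT => /forallNP ju; apply: u0'; apply: Vinj => j.
  by apply/eqP/negPn/negP; exact: ju.
have jS : j \notin S by apply: contra_neqN ju => /Su.
have rS' := leq_ltn_trans rS (rank_maskmx_setU1 Su ju).
apply: (IH (j |: S) (y' + t *: u)) => //.
- have Sn' : (#|S| < n)%N by exact: leq_trans rS' (rank_leq_col _).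
  by rewrite cardsU1 jS add1n -ltnS; apply: leq_trans nk; rewrite ltnS ltn_sub2l.
- by rewrite cardsU1 jS.
- move=> i /setU1P[->//|iS].
  by rewrite dotpDr dotpZr Su// mulr0 addr0 Sc.
- by rewrite dotpDr dotpZr; apply: le_trans xy' _; rewrite lerDl mulr_ge0.
Qed.

(* Solves A z = e up to the factor det (A^T A); by Cramer's rule this is
   polynomial in A, hence measurable. *)
Definition vertex_dir {M n} (A : 'M[R]_(M, n)) (e : 'cV[R]_M) : 'rV[R]_n :=
  (\adj (A^T *m A) *m (A^T *m e))^T.

Lemma det_gram_neq0 {M n} (A : 'M[R]_(M, n)) :
  (forall u : 'rV_n, A *m u^T = 0 -> u = 0) -> \det (A^T *m A) != 0.
Proof.
move=> Ainj; apply/negP => /det0P[u u0]; rewrite mulmxA => uA.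
move/eqP: u0; apply; apply: Ainj.
have : dotp (u *m A^T) (u *m A^T) <= 0.
  by rewrite dotp_mulmx [in X in _ *m X]trmx_mul trmxK mulmxA uA mul0mx mxE.
by move/dotp_eq0 => /(congr1 trmx); rewrite trmx_mul trmxK trmx0.
Qed.

(** From adj(A^T A) A^T A = det(A^T A); a degenerate A only makes the scalar zero. *)
Lemma vertex_dirE {M n} (A : 'M[R]_(M, n)) (e : 'cV[R]_M) (z : 'rV[R]_n) c :
  c != 0 -> A *m z^T = c *: e ->
  vertex_dir A e = (\det (A^T *m A) / c) *: z.
Proof.
move=> c0 Az; rewrite /vertex_dir.
rewrite (_ : e = c^-1 *: (A *m z^T)); last by rewrite Az scalerA mulVf// scale1r.
rewrite -!scalemxAr 2!mulmxA -[_ *m _ *m A]mulmxA mul_adj_mx mul_scalar_mx.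
by rewrite scalerA linearZ/= trmxK mulrC.
Qed.

Definition signmx {M} (S Q : {set 'I_M}) : 'cV[R]_M :=
  \col_j if j \in S then (-1) ^+ (j \notin Q) else 0.

(** The common level c of the active constraints is unknown, but missing is homogeneous in the
    direction, so the pair (S, Q) is enough data. Q stands for the active rows whose inner product
    is positive. *)
Definition vertex_of {N n} (eta : R) (S Q : {set 'I_(N + n)})
    (v : 'I_N -> 'rV[R]_n) : 'rV[R]_n :=
  vertex_dir (maskmx S (col_mx (\matrix_j v j) eta%:M)) (signmx S Q).

(* The rows eta e_i make the polytope bounded and are never violated. *)
Lemma missed_vertex {N n} (v : 'I_N -> 'rV[R]_n) (q : R) (q' : \bar R)
    (r eta : R) (y : 'rV[R]_n) : (0 < N)%N ->
  1 <= q -> (q%:E^-1 + q'^-1 = 1)%E -> 0 < eta < r ->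
  (forall j, `|dotp (v j) y| < r * lnorm q%:E y) ->
  exists S Q : {set 'I_(N + n)}, [/\ (#|S| <= n)%N, Q \subset S &
    forall j, `|dotp (v j) (vertex_of eta S Q v)|
      < r * lnorm q%:E (vertex_of eta S Q v)].
Proof.
move=> N0 q1 qq' /andP[eta0 etar] yr.
have q0 : 0 < q by exact: lt_le_trans q1.
have r0 : 0 < r by exact: lt_trans etar.
have ny0 : 0 < lnorm q%:E y.
  by rewrite -(pmulr_rgt0 _ r0); exact: le_lt_trans (yr (Ordinal N0)).
set V := col_mx (\matrix_j v j) eta%:M : 'M[R]_(N + n, n).
have VL j : row (lshift n j) V = v j.
  by rewrite rowKu; apply/rowP => i; rewrite !mxE.
have VR i u : dotp (row (rshift N i) V) u = eta * u ord0 i.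
  rewrite rowKd /dotp (bigD1 i)//= big1 ?addr0 => [|k ki].
    by rewrite !mxE eqxx mulr1n.
  by rewrite !mxE eq_sym (negbTE ki) mulr0n mul0r.
have Vinj u : (forall j, dotp (row j V) u = 0) -> u = 0.
  move=> Vu; apply/rowP => i; rewrite mxE; apply/eqP.
  by have /eqP := Vu (rshift N i); rewrite VR mulf_eq0 gt_eqF.
have Vy j : `|dotp (row j V) y| < r * lnorm q%:E y.
  case: (split_ordP j) => i ->; first by rewrite VL.
  rewrite VR normrM gtr0_norm//; apply: (@le_lt_trans _ _ (eta * lnorm q%:E y)).
    by rewrite ler_pM2l// ler_coord_lnorm.
  by rewrite ltr_pM2r.
(* The level c is the largest value attained at y, strictly below r |y|_q, so all rows still miss
   strictly once y is moved to a vertex z of no smaller norm. It is positive thanks to the rows eta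
   e_i. *)
have [c [c0 cr yc]] : exists c, [/\ 0 < c, c < r * lnorm q%:E y &
    forall j, `|dotp (row j V) y| <= c].
  case: (Order.TotalTheory.arg_maxP (fun j => `|dotp (row j V) y|)
    (isT : predT (lshift n (Ordinal N0)))) => j _ jm.
  exists (`|dotp (row j V) y|); split => // [|i]; last exact: jm.
  rewrite lt_def normr_ge0 andbT; apply/negP => /eqP j0.
  suff y0 : y = 0 by move: ny0; rewrite y0 lnorm0// ltxx.
  by apply: Vinj => i; apply/eqP; rewrite -normr_le0; have := jm i isT; rewrite j0.
have [x x1 xy] := lnorm_norming y q1 qq'.
have [S [z [Sn zc Sz Sinj xz]]] := lp_vertex x Vinj yc.
exists S, [set j in S | 0 <= dotp (row j V) z]%SET; split; first exact: Sn.
  by apply/fintype.subsetP => j; rewrite inE => /andP[].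
have yz : lnorm q%:E y <= lnorm q%:E z.
  by rewrite -xy; apply: le_trans xz _; exact: lnorm_hoelder qq' x1.
set Q := [set j in S | _]%SET.
have Az : maskmx S V *m z^T = c *: signmx S Q.
  apply/colP => j; rewrite mulmx_trE row_maskmx !mxE; case: ifPn => jS; last first.
    by rewrite dotpC dotp0r mulr0.
  rewrite !inE jS/=; have := Sz j jS.
  case: (leP 0 (dotp _ z)) => h.
    by rewrite ger0_norm// expr0 mulr1.
  by rewrite ltr0_norm// expr1 mulrN1 => <-; rewrite opprK.
rewrite /vertex_of (vertex_dirE (lt0r_neq0 c0) Az).
(* Both sides of the miss inequality scale by |a|, so it remains to see that the Gram determinant is
   nonzero. *)
set a := _ / c; have a0 : 0 < `|a|.
  rewrite normr_gt0; apply: mulf_neq0; last by rewrite invr_eq0 gt_eqF.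
  apply: det_gram_neq0 => u u0.
  apply: Sinj => j jS; rewrite -[row j V](_ : row j (maskmx S V) = _).
    by rewrite -mulmx_trE u0 mxE.
  by rewrite row_maskmx jS.
move: a a0 => {Az} a a0 j.
rewrite dotpZr (lnormZ a z q0) normrM mulrCA (ltr_pM2l a0) -VL.
apply: le_lt_trans (zc _) _; apply: lt_le_trans cr _.
by rewrite (ler_pM2l r0).
Qed.

(** What conditioning relies on: freezing the sample rows in S freezes the candidate. *)
Lemma vertex_of_local {N n} (eta : R) (S Q : {set 'I_(N + n)})
    (v w : 'I_N -> 'rV[R]_n) :
  (forall j, lshift n j \in S -> v j = w j) ->
  vertex_of eta S Q v = vertex_of eta S Q w.
Proof.
move=> vw; rewrite /vertex_of; congr (vertex_dir _ _).
apply/matrixP => j i; rewrite !mxE; case: ifP => // jS.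
by case: splitP => k jk; rewrite !mxE// vw// (_ : lshift n k = j)//; exact/val_inj.
Qed.

End Vertices.

(** * Independent blocks *)

Lemma bounded_integrable {R : realType} d (T : measurableType d)
    (P : probability T R) (f : T -> R) (K : R) : measurable_fun [set: T] f ->
  (forall w, `|f w| <= K) -> P.-integrable [set: T] (EFin \o f).
Proof.
move=> mf fK; apply: measurable_bounded_integrable => //.
  by rewrite (le_lt_trans (probability_le1 _ _)) ?ltry.
exists K; split; first exact: num_real.
by move=> M KM w _ /=; exact: le_trans (fK w) (ltW KM).
Qed.

Section Blocks.
Context {d : measure_display} {T : measurableType d} {R : realType}.
Variable P : probability T R.
Context {d' : measure_display} {T' : measurableType d'}.
Variables (t0 : T') (m : nat).

Definition box (F : 'I_m -> set T') : set (m.-tuple T') :=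
  [set t | forall i, F i (tnth t i)].

Definition boxes : set (set (m.-tuple T')) :=
  [set box F | F in [set F | forall i, measurable (F i)]].

Lemma measurable_box F : (forall i, measurable (F i)) -> measurable (box F).
Proof.
move=> mF; rewrite (_ : box F =
    \big[setI/setT]_(i < m) ((@tnth m T')^~ i @^-1` F i)).
  apply: bigsetI_measurable => i _.
  by rewrite -[X in measurable X]setTI; exact: measurable_tnth.
rewrite -bigcap_seq; apply/seteqP; split => t /= h i.
  by move=> _; exact: h.
by apply: h; rewrite /= mem_index_enum.
Qed.

Lemma measurable_tuple_boxes : @measurable _ (m.-tuple T') = <<s boxes >>.
Proof.
apply/seteqP; split; last first.
  apply: smallest_sub; first exact: sigma_algebra_measurable.
  by move=> _ [F mF <-]; exact: measurable_box.
apply: smallest_sub; first exact: smallest_sigma_algebra.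
move=> A; rewrite -bigcup_seq => -[i _ [B mB <-]]; apply: sub_sigma_algebra.
exists (fun j => if j == i then B else setT) => [j /=|]; first by case: ifP.
apply/seteqP; split => t /=.
  by move=> /(_ i); rewrite eqxx; split.
by move=> [_ Bt] j; case: ifPn => // /eqP ->.
Qed.

Lemma setI_closed_boxes : setI_closed boxes.
Proof.
move=> _ _ [F mF <-] [G mG <-].
exists (fun i => F i `&` G i) => [i /=|]; first exact: measurableI.
apply/seteqP; split => t /=; first by move=> h; split => i; have [] := h i.
by move=> [h1 h2] i; split; [exact: h1|exact: h2].
Qed.

Lemma tuple_measure_unique (m1 m2 : {measure set (m.-tuple T') -> \bar R}) :
  (m1 setT < +oo)%E -> (forall F, (forall i, measurable (F i)) ->
    m1 (box F) = m2 (box F)) ->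
  forall A, measurable A -> m1 A = m2 A.
Proof.
move=> fin h A mA; apply: (measure_unique boxes (fun=> setT)) => //.
- exact: measurable_tuple_boxes.
- exact: setI_closed_boxes.
- by move=> _; exists (fun=> setT) => //; apply/seteqP; split.
- by rewrite bigcup_const//; exists 0%N.
- by move=> _ [F mF <-]; exact: h.
Qed.

(** Both sides are finite measures in A that agree on boxes, a generating pi-system. *)
Lemma tuple_event_indep (Y : {mfun T >-> m.-tuple T'}) (C : set T) :
  measurable C ->
  (forall F, (forall i, measurable (F i)) ->
    P (Y @^-1` box F `&` C) = P (Y @^-1` box F) * P C)%E ->
  forall A, measurable A -> P (Y @^-1` A `&` C) = (P (Y @^-1` A) * P C)%E.
Proof.
move=> mC h A mA.
pose m1 := pushforward (mrestr P mC) Y.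
have r0 : 0 <= fine (P C) by exact: fine_ge0.
pose m2 := mscale (NngNum r0) (distribution P Y).
have rE : (fine (P C))%:E = P C by rewrite fineK// fin_num_measure.
have m2E B : m2 B = (P (Y @^-1` B) * P C)%E by rewrite /m2 /mscale/= rE muleC.
rewrite -m2E; apply: (@tuple_measure_unique m1 m2) => //.
  rewrite /m1 /pushforward/= /mrestr (le_lt_trans (probability_le1 _ _)) ?ltry//.
  by rewrite preimage_setT setTI.
by move=> F mF; rewrite -[RHS]/(m2 (box F)) m2E -h.
Qed.

Variable X : 'I_m -> {mfun T >-> T'}.

(* Entries outside S are masked by t0, so that complementary blocks have the
   same type. *)
Definition block (S : {set 'I_m}) (w : T) : m.-tuple T' :=
  [tuple if i \in S then X i w else t0 | i < m].

Lemma measurable_block S : measurable_fun [set: T] (block S).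
Proof.
apply/measurable_fun_tnthP => i.
rewrite (_ : _ \o _ = if i \in S then X i else cst t0).
  by case: ifP => _; [exact: measurable_funPT|exact: measurable_cst].
by apply/funext => w /=; rewrite tnth_mktuple; case: ifP.
Qed.

HB.instance Definition _ S :=
  isMeasurableFun.Build _ _ _ _ (block S) (measurable_block S).

(** A masked coordinate is the constant t0, so a constraint on it holds either everywhere or
    nowhere. *)
Lemma preimage_block_box S F :
  block S @^-1` box F = set0 \/
  block S @^-1` box F = \bigcap_(i in [set` S]) (X i @^-1` F i).
Proof.
have [h|/existsNP[i /not_implyP[iS Fi]]] :=
    pselect (forall i, i \notin S -> F i t0); [right|left].
  apply/seteqP; split => w /= hw i.
    by move=> /= iS; have := hw i; rewrite tnth_mktuple iS.
  by rewrite tnth_mktuple; case: ifPn => iS; [exact: hw|exact: h].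
apply/seteqP; split => // w /= /(_ i).
by rewrite tnth_mktuple (negbTE iS).
Qed.

Hypothesis indX : independent_RVs P X.

Lemma block_box_indep (S : {set 'I_m}) F G :
  (forall i, measurable (F i)) -> (forall i, measurable (G i)) ->
  P (block S @^-1` box F `&` block (~: S)%SET @^-1` box G) =
  (P (block S @^-1` box F) * P (block (~: S)%SET @^-1` box G))%E.
Proof.
move=> mF mG.
have [->|eF] := preimage_block_box S F; first by rewrite set0I measure0 mul0e.
have [->|eG] := preimage_block_box (~: S)%SET G.
  by rewrite setI0 measure0 mule0.
rewrite eF eG !indX//.
(* Independence of the whole family is applied to the glued events, F on S and G off S. *)
have := @indX [set: 'I_m]%SET (fun i => if i \in S then F i else G i).
rewrite (_ : \bigcap_(i in _) _ = (\bigcap_(i in [set` S]) X i @^-1` F i) `&`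
   (\bigcap_(i in [set` (~: S)%SET]) X i @^-1` G i)); last first.
  apply/seteqP; split => w /=.
    move=> h; split => i /= iS; have := h i; rewrite /= finset.in_setT ?iS.
      by apply.
    by move: iS; rewrite finset.in_setC => /negbTE ->; apply.
  move=> [h1 h2] i /= _; case: ifPn => iS; first exact: h1.
  by apply: h2; rewrite /= finset.in_setC.
move=> ->; last by move=> i _; case: ifP.
rewrite (bigID (mem S))/=; congr (_ * _)%E.
  apply: eq_big => [i|i iS]; first by rewrite finset.in_setT.
  by move: iS; rewrite finset.in_setT/= => ->.
apply: eq_big => [i|i iS]; first by rewrite finset.in_setT finset.in_setC.
by move: iS; rewrite finset.in_setT/= => /negbTE ->.
Qed.

(** Boxes are replaced by measurable sets one block at a time, the event of the other block being
    held fixed. *)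
Lemma block_indep (S : {set 'I_m}) A B : measurable A -> measurable B ->
  P (block S @^-1` A `&` block (~: S)%SET @^-1` B) =
  (P (block S @^-1` A) * P (block (~: S)%SET @^-1` B))%E.
Proof.
move=> mA mB; apply: (@tuple_event_indep (block S)) => // [|F mF].
  exact: measurable_funPTI.
rewrite setIC muleC.
apply: (@tuple_event_indep (block (~: S)%SET)) => // [|G mG].
  by apply: measurable_funPTI; exact: measurable_box.
by rewrite setIC muleC block_box_indep.
Qed.

Definition block_pair (S : {set 'I_m}) (w : T) :=
  (block S w, block (~: S)%SET w).

Lemma measurable_block_pair S : measurable_fun [set: T] (block_pair S).
Proof. by apply: measurable_fun_pair; exact: measurable_block. Qed.

HB.instance Definition _ S :=
  isMeasurableFun.Build _ _ _ _ (block_pair S) (measurable_block_pair S).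

Lemma block_joint_law (S : {set 'I_m}) D : measurable D ->
  distribution P (block_pair S) D =
  (distribution P (block S) \x distribution P (block (~: S)%SET))%E D.
Proof.
move=> mD; apply/esym.
rewrite (@product_measure_unique _ _ _ _ _ _ _
  (distribution P (block_pair S)))//.
by move=> A B mA mB; rewrite -block_indep.
Qed.

Lemma block_expectM (S : {set 'I_m}) (f g : m.-tuple T' -> R) :
  measurable_fun [set: _] f -> measurable_fun [set: _] g ->
  (forall t, `|f t| <= 1) -> (forall t, `|g t| <= 1) ->
  \int[P]_w (f (block S w) * g (block (~: S)%SET w)) =
  (\int[P]_w f (block S w)) * (\int[P]_w g (block (~: S)%SET w)).
Proof.
move=> mf mg f1 g1.
have mh : measurable_fun [set: (m.-tuple T' * m.-tuple T')%type]
    (fun z => f z.1 * g z.2).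
  by apply: measurable_funM; apply: measurableT_comp.
have h1 z : `|f z.1 * g z.2| <= 1 by rewrite normrM mulr_ile1.
set mu := distribution P (block S); set nu := distribution P (block (~: S)%SET).
have intg : nu.-integrable setT (EFin \o g).
  exact: bounded_integrable mg g1.
have intf : mu.-integrable setT (EFin \o f).
  exact: bounded_integrable mf f1.
have int_f : (\int[mu]_x f x) = \int[P]_w f (block S w).
  congr fine; apply: integral_distribution; first exact/measurable_EFinP.
  apply: (@bounded_integrable R _ _ P (f \o block S) 1) => [|w]; last exact: f1.
  exact: measurableT_comp (measurable_block S).
have int_g : (\int[nu]_x g x) = \int[P]_w g (block (~: S)%SET w).
  congr fine; apply: integral_distribution; first exact/measurable_EFinP.
  apply: (@bounded_integrable R _ _ P (g \o block (~: S)%SET) 1) => [|w].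
    exact: measurableT_comp (measurable_block _).
  exact: g1.
rewrite -int_f -int_g; rewrite [LHS]/Rintegral.
have -> : (\int[P]_w (f (block S w) * g (block (~: S)%SET w))%:E)%E =
    (\int[distribution P (block_pair S)]_z (f z.1 * g z.2)%:E)%E.
  apply/esym/integral_distribution; first exact/measurable_EFinP.
  apply: (@bounded_integrable R _ _ P
    ((fun z => f z.1 * g z.2) \o block_pair S) 1) => [|w]; last exact: h1.
  exact: measurableT_comp (measurable_block_pair S).
rewrite (@eq_measure_integral _ _ _ _ (mu \x nu)%E); last first.
  by move=> D mD _; exact: block_joint_law.
have inth : (mu \x nu)%E.-integrable setT
    (fun z : m.-tuple T' * m.-tuple T' => (f z.1 * g z.2)%:E).
  apply/integrable12ltyP; first exact/measurable_EFinP.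
  apply: (@le_lt_trans _ _ (\int[mu]_x \int[nu]_y 1)%E).
    apply: ge0_le_integral => //.
    - by move=> x _; exact: integral_ge0.
    - apply: (measurable_fun_fubini_tonelli_F
        (fun z : m.-tuple T' * m.-tuple T' => `|(f z.1 * g z.2)%:E|%E)) => //.
      by apply: measurableT_comp => //; exact/measurable_EFinP.
    - move=> x _; apply: ge0_le_integral => //.
        apply: measurableT_comp => //; apply/measurable_EFinP.
        exact: (measurable_funM (measurable_cst (f x)) mg).
      by move=> y _; rewrite lee_fin (h1 (x, y)).
  rewrite (eq_integral (cst 1%E)) => [|x _].
    rewrite integral_cst// mul1e.
    exact: le_lt_trans (probability_le1 (distribution P (block S)) _) (ltry 1).
  rewrite -[LHS]/(\int[nu]_y cst 1 y)%E integral_cst// mul1e.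
  exact: (probability_setT (distribution P (block (~: S)%SET))).
rewrite -integral12_prod_meas1//= /fubini_F/=.
transitivity (\int[mu]_x (f x * \int[nu]_y g y)).
  congr fine; apply: eq_integral => x _.
  rewrite -RintegralZl// /Rintegral fineK//.
  apply: integrable_fin_num => //.
  apply: (@bounded_integrable R _ _ (distribution P (block (~: S)%SET))
    (fun y => f x * g y) 1) => [|y]; last exact: (h1 (x, y)).
  exact: (measurable_funM (measurable_cst (f x)) mg).
by rewrite RintegralZr.
Qed.

End Blocks.

(** * Stable laws *)

Section StableLinearForms.
Context {d : measure_display} {T : measurableType d} {R : realType}.
Variable P : probability T R.

Lemma measurable_cos : measurable_fun [set: R] (@cos R).
Proof. by apply: continuous_measurable_fun; exact: continuous_cos. Qed.

Lemma measurable_sin : measurable_fun [set: R] (@sin R).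
Proof. by apply: continuous_measurable_fun; exact: continuous_sin. Qed.

Lemma equal_in_law_Rintegral (X Y : {mfun T >-> R}) (f : R -> R) :
  equal_in_law P X Y -> measurable_fun [set: R] f -> (forall x, `|f x| <= 1) ->
  \int[P]_w f (X w) = \int[P]_w f (Y w).
Proof.
move=> XY mf f1.
have h (Z : {mfun T >-> R}) :
    \int[P]_w f (Z w) = fine (\int[distribution P Z]_x (f x)%:E)%E.
  congr fine; apply/esym/integral_distribution; first exact/measurable_EFinP.
  apply: (@bounded_integrable R _ _ P (f \o Z) 1) => [|w]; last exact: f1.
  exact: measurableT_comp.
rewrite !h; congr fine; apply: eq_measure_integral => A mA _.
exact: XY.
Qed.

(** Multiplicativity of characteristic functions in real form. The sine is carried along because the
    addition formulas couple it with the cosine; its mean stays 0 since the characteristic function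
    of xi is real. *)
Lemma stable_linear_form_prefix (q : R) (n : nat) (xi : {mfun T >-> R})
    (xs : 'I_n -> {mfun T >-> R}) (a : 'I_n -> R) :
  standard_stable P q xi -> independent_copies P xi xs ->
  forall k, (k <= n)%N ->
  \int[P]_w cos (\sum_(i < n | (i < k)%N) a i * xs i w) =
    expR (- ((\sum_(i < n | (i < k)%N) `|a i| `^ q) / 2)) /\
  \int[P]_w sin (\sum_(i < n | (i < k)%N) a i * xs i w) = 0.
Proof.
move=> sxi [ind law].
have xiE t : \int[P]_w cos (t * xi w) = expR (- (`|t| `^ q / 2)) /\
    \int[P]_w sin (t * xi w) = 0.
  have := sxi t; rewrite /char_fun expectation.unlock => -[<- h].
  by split => //; rewrite -[RHS]h expectation.unlock.
have xsE i : \int[P]_w cos (a i * xs i w) = expR (- (`|a i| `^ q / 2)) /\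
    \int[P]_w sin (a i * xs i w) = 0.
  have mM : measurable_fun [set: R] (fun x => a i * x).
    by apply: measurable_funM => //; exact: measurable_cst.
  have [<- <-] := xiE (a i); split.
    apply: (@equal_in_law_Rintegral _ _ (fun x => cos (a i * x)) (law i)).
      exact: measurableT_comp measurable_cos mM.
    by move=> x; exact: cos_max.
  apply: (@equal_in_law_Rintegral _ _ (fun x => sin (a i * x)) (law i)).
    exact: measurableT_comp measurable_sin mM.
  by move=> x; exact: sin_max.
elim => [_|k IH kn].
  under eq_Rintegral do rewrite big_pred0//.
  under [X in _ /\ X = _]eq_Rintegral do rewrite big_pred0//.
  rewrite big_pred0// mul0r oppr0 cos0 sin0 expR0 !Rintegral_cst//.
  rewrite mul0r mul1r; split => //.
  exact: (congr1 fine (probability_setT P)).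
have [IHc IHs] := IH (ltnW kn).
pose i0 := Ordinal kn.
have split_sum (F : 'I_n -> R) : \sum_(i < n | (i < k.+1)%N) F i =
    \sum_(i < n | (i < k)%N) F i + F i0.
  rewrite (bigD1 i0)//= addrC; congr (_ + _); apply: eq_bigl => i.
  by rewrite ltnS leq_eqVlt -(inj_eq val_inj)/=; case: ltngtP.
pose S := [set i : 'I_n | (i < k)%N]%SET.
pose L (t : n.-tuple R) := \sum_(i < n | (i < k)%N) a i * tnth t i.
pose M (t : n.-tuple R) := a i0 * tnth t i0.
have mM : measurable_fun [set: n.-tuple R] M.
  by apply: measurable_funM => //; exact: measurable_tnth.
have mL : measurable_fun [set: n.-tuple R] L.
  rewrite (_ : L = fun t => \sum_(i < n) if (i < k)%N then a i * tnth t i else 0);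
    last by apply/funext => t; rewrite /L big_mkcond.
  apply: measurable_sum => i; case: (i < k)%N => //.
  by apply: measurable_funM => //; exact: measurable_tnth.
have LE w : L (block (0 : R) xs S w) = \sum_(i < n | (i < k)%N) a i * xs i w.
  by apply: eq_bigr => i ik; rewrite tnth_mktuple inE ik.
have ME w : M (block (0 : R) xs (~: S)%SET w) = a i0 * xs i0 w.
  by rewrite /M tnth_mktuple !inE ltnn.
have prodE (f g : R -> R) : measurable_fun [set: R] f ->
    measurable_fun [set: R] g -> (forall x, `|f x| <= 1) ->
    (forall x, `|g x| <= 1) ->
    \int[P]_w (f (\sum_(i < n | (i < k)%N) a i * xs i w) * g (a i0 * xs i0 w)) =
    \int[P]_w (f (\sum_(i < n | (i < k)%N) a i * xs i w)) *
    \int[P]_w (g (a i0 * xs i0 w)).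
  move=> mf mg f1 g1.
  have := @block_expectM _ _ _ P _ _ (0 : R) n xs ind S (f \o L) (g \o M).
  rewrite /= => h.
  under eq_Rintegral do rewrite -LE -ME.
  rewrite h//; last 2 first.
  - exact: measurableT_comp.
  - exact: measurableT_comp.
  by congr (_ * _); apply: eq_Rintegral => w _; rewrite ?LE ?ME.
have mLw : measurable_fun [set: T] (fun w => \sum_(i < n | (i < k)%N) a i * xs i w).
  under eq_fun do rewrite -LE.
  exact: measurableT_comp mL (measurable_block (0 : R) xs S).
have mMw : measurable_fun [set: T] (fun w => a i0 * xs i0 w).
  by apply: measurable_funM => //; exact: measurable_funPT.
have intp (f g : R -> R) : measurable_fun [set: R] f ->
    measurable_fun [set: R] g -> (forall x, `|f x| <= 1) ->
    (forall x, `|g x| <= 1) -> P.-integrable [set: T] (EFin \o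
      (fun w => f (\sum_(i < n | (i < k)%N) a i * xs i w) * g (a i0 * xs i0 w))).
  move=> mf mg f1 g1; apply: (@bounded_integrable R _ _ P _ 1) => [|w].
    by apply: measurable_funM; exact: measurableT_comp.
  by rewrite normrM mulr_ile1.
have [mc ms] := (measurable_cos, measurable_sin).
have [c1 s1] := (@cos_max R, @sin_max R).
have [xc xs'] := xsE i0.
split.
  under eq_Rintegral do rewrite split_sum cosD.
  rewrite RintegralB//; [|exact: intp|exact: intp].
  rewrite !prodE// IHc IHs xc mul0r subr0 -expRD split_sum; congr expR.
  by rewrite mulrDl opprD.
under eq_Rintegral do rewrite split_sum sinD.
rewrite RintegralD//; [|exact: intp|exact: intp].
by rewrite !prodE// IHc IHs xs' mul0r mulr0 addr0.
Qed.

Lemma stable_linear_form (q : R) (n : nat) (xi : {mfun T >-> R})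
    (xs : 'I_n -> {mfun T >-> R}) (y : 'rV[R]_n) (t : R) : 0 < q ->
  standard_stable P q xi -> independent_copies P xi xs ->
  \int[P]_w cos (t * dotp (row_of_tuple (random_vector xs w)) y) =
    expR (- (`|t| `^ q * lnorm q%:E y `^ q / 2)).
Proof.
move=> q0 sxi ixs.
have [h _] := @stable_linear_form_prefix q n xi xs
  (fun i => t * y ord0 i) sxi ixs n (leqnn n).
transitivity (\int[P]_w cos (\sum_(i < n | (i < n)%N) t * y ord0 i * xs i w)).
  apply: eq_Rintegral => w _; congr cos; rewrite /dotp mulr_sumr.
  apply: eq_big => [i|i _]; first by rewrite ltn_ord.
  by rewrite !mxE tnth_mktuple; ring.
rewrite h; congr (expR (- (_ / 2))); rewrite lnorm_powR// mulr_sumr.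
apply: eq_big => [i|i _]; first by rewrite ltn_ord.
by rewrite normrM powRM.
Qed.

End StableLinearForms.

(** * Quadratic bounds for 1 - cos *)

Section CosineBounds.
Context {R : realType}.
Implicit Type x : R.

Lemma sin_MVT x : 0 <= x -> exists2 c : R, 0 <= c <= x & sin x = cos c * x.
Proof.
move=> x0.
have [|c cx] := @MVT_segment R sin cos 0 x x0 (fun y _ => is_derive_sin y).
  by apply: continuous_subspaceT; exact: continuous_sin.
by rewrite sin0 !subr0 => e; exists c => //; move: cx; rewrite in_itv.
Qed.

Lemma one_sub_cosE x : 1 - cos x = 2 * sin (`|x| / 2) ^+ 2.
Proof.
rewrite -cos_norm -[in cos _](_ : (`|x| / 2) *+ 2 = `|x|).
  by rewrite cos_mulr2n cos2sin2 mulr2n; ring.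
by rewrite -[_ *+ 2]mulr_natr mulfVK.
Qed.

Lemma one_sub_cos_le x : 1 - cos x <= x ^+ 2 / 2.
Proof.
have x0 : 0 <= `|x| / 2 by rewrite divr_ge0.
have [c _ e] := sin_MVT x0.
rewrite one_sub_cosE e exprMn.
have c1 : cos c ^+ 2 <= 1 by rewrite cos2sin2 lerBlDr lerDl sqr_ge0.
have -> : x ^+ 2 = `|x| ^+ 2 by rewrite -normrX ger0_norm ?sqr_ge0.
rewrite expr_div_n; have := sqr_ge0 `|x|; nra.
Qed.

Lemma one_sub_cos_ge x : `|x| <= 1 -> x ^+ 2 / 4 <= 1 - cos x.
Proof.
move=> x1; have x0 : 0 <= `|x| / 2 by rewrite divr_ge0.
have [c /andP[c0 cx] e] := sin_MVT x0.
(* Bootstraps the upper bound: c <= 1/2 gives cos c >= 1 - 1/8, and 2 (49/64) (x^2/4) still exceeds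
   x^2/4. *)
have c7 : 7 / 8 <= cos c by have := one_sub_cos_le c; nra.
have c49 : 49 / 64 <= cos c ^+ 2 by nra.
rewrite one_sub_cosE e exprMn.
have -> : x ^+ 2 = `|x| ^+ 2 by rewrite -normrX ger0_norm ?sqr_ge0.
rewrite expr_div_n; have := sqr_ge0 `|x|; nra.
Qed.

End CosineBounds.

Section StableTail.
Context {d : measure_display} {T : measurableType d} {R : realType}.
Variable P : probability T R.

(** The base e = (1/8)^(1/(2-q)) solves e^2 = e^q / 8. The main term e^q u^-q / 4 then exceeds the
    truncation error by e^q u^-q / 8, and the bound 1 - cos <= 2 above the truncation level halves
    this. *)
Definition stable_tail_const (q : R) : R := (8^-1 `^ (2 - q)^-1) `^ q / 16.

Lemma stable_tail_const_gt0 q : 0 < stable_tail_const q.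
Proof. by rewrite divr_gt0// powR_gt0// powR_gt0. Qed.

(** The lower bound comes from exp(-y) <= 1/(1 + y) and y/(1 + y) >= y/2 on [0, 1]. *)
Lemma one_sub_expRN_bounds (y : R) : 0 <= y -> y <= 1 ->
  y / 2 <= 1 - expR (- y) <= y.
Proof.
move=> y0 y1; apply/andP; split; last first.
  by have := expR_ge1Dx (- y); lra.
have e1 := expR_ge1Dx y.
have e2 : expR (- y) * expR y = 1 by rewrite -expRD addNr expR0.
have e3 : 0 < expR (- y) by exact: expR_gt0.
nra.
Qed.

(* Truncation at level u: the part below u is controlled by 1 - cos(Y/u),
   whose mean is O(u^-q), while 1 - cos(eps Y/u) has mean at least
   (eps/u)^q/4, which dominates for small eps since q < 2. *)
Lemma stable_tail (q : R) (Y : T -> R) (u : R) : 1 <= q < 2 ->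
  measurable_fun [set: T] Y ->
  (forall t, \int[P]_w cos (t * Y w) = expR (- (`|t| `^ q / 2))) -> 1 <= u ->
  ((stable_tail_const q * u `^ (- q))%:E <= P [set w | (u < `|Y w|)%R])%E.
Proof.
move=> /andP[q1 q2] mY cY u1.
have q0 : 0 < q by exact: lt_le_trans q1.
have u0 : 0 < u by exact: lt_le_trans u1.
set e : R := 8^-1 `^ (2 - q)^-1.
have e0 : 0 < e by exact: powR_gt0.
have e1 : e <= 1.
  rewrite /e -[leRHS](one_powR (2 - q)^-1) ge0_ler_powR ?nnegrE//; last by lra.
  by rewrite invr_ge0; lra.
have e2 : e ^+ 2 = e `^ q / 8.
  rewrite -powR_mulrn ?(ltW e0)// -[2%:R](subrK q) powRD; last first.
    by rewrite (gt_eqF e0) implybT.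
  rewrite mulrC; congr (_ * _).
  by rewrite /e -powRrM mulVf ?powRr1// subr_eq0 gt_eqF.
set A := [set w | u < `|Y w|].
have mA : measurable A.
  have mN : measurable_fun [set: T] (fun w => `|Y w|) by exact: measurableT_comp.
  rewrite (_ : A = [set: T] `&` (fun w => `|Y w|) @^-1` `]u, +oo[); first exact: mN.
  by rewrite setTI; apply/seteqP; split => w /=; rewrite in_itv/= andbT.
set s := e / u.
have s0 : 0 < s by rewrite divr_gt0.
have su : s * u = e by rewrite mulfVK// gt_eqF.
(* Below u, 1 - cos(s Y) <= e^2 (Y/u)^2 / 2 and (Y/u)^2 <= 4 (1 - cos(Y/u)), since |Y/u| <= 1. Above
   u, 1 - cos <= 2. *)
have pw w : 1 - cos (s * Y w) <=
    2 * \1_A w + 2 * e ^+ 2 * (1 - cos (u^-1 * Y w)).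
  rewrite indicE; have [wA|wA] := boolP (w \in A).
    have := cos_geN1 (s * Y w); have := cos_le1 (u^-1 * Y w).
    have := sqr_ge0 e; rewrite mulr1; nra.
  have {}wA : `|Y w| <= u.
    by rewrite leNgt; apply: contra wA => h; exact/mem_set.
  rewrite mulr0 add0r; apply: le_trans (one_sub_cos_le _) _.
  have : `|u^-1 * Y w| <= 1.
    by rewrite normrM gtr0_norm ?invr_gt0// mulrC ler_pdivrMr// mul1r.
  move/one_sub_cos_ge.
  have -> : s * Y w = e * (u^-1 * Y w) by rewrite mulrA.
  by rewrite exprMn; have := sqr_ge0 e; nra.
have mcos t : measurable_fun [set: T] (fun w => cos (t * Y w)).
  apply: measurableT_comp measurable_cos _.
  by apply: measurable_funM => //; exact: measurable_cst.
have intc t : P.-integrable [set: T] (EFin \o (fun w => cos (t * Y w))).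
  by apply: (@bounded_integrable R _ _ P _ 1) => // w; exact: cos_max.
have int1 (r : R) : P.-integrable [set: T] (EFin \o (fun=> r)).
  by apply: (@bounded_integrable R _ _ P _ `|r|) => //; exact: measurable_cst.
have intI : P.-integrable [set: T] (EFin \o \1_A).
  apply: (@bounded_integrable R _ _ P _ 1) => [|w]; first exact: measurable_indic.
  by rewrite indicE; case: (_ \in _); rewrite ?normr1 ?normr0.
have PT : fine (P [set: T]) = 1 by exact: (congr1 fine (probability_setT P)).
have cE t : \int[P]_w (1 - cos (t * Y w)) = 1 - expR (- (`|t| `^ q / 2)).
  by rewrite RintegralB// cY Rintegral_cst// mul1r PT.
have key : 1 - expR (- (`|s| `^ q / 2)) <=
    2 * fine (P A) + 2 * e ^+ 2 * (1 - expR (- (`|u^-1| `^ q / 2))).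
  rewrite -!cE -[fine (P A)](_ : \int[P]_w \1_A w = _); last first.
    by rewrite /Rintegral integral_indic// setIT.
  have intc' t : P.-integrable [set: T] (EFin \o (fun w => 1 - cos (t * Y w))).
    exact: (integrableB measurableT (int1 1) (intc t)).
  rewrite -!RintegralZl// -RintegralD//; last 2 first.
  - exact: (integrableZl measurableT 2 intI).
  - exact: (integrableZl measurableT (2 * e ^+ 2) (intc' u^-1)).
  apply: le_Rintegral => //.
  exact: (integrableD measurableT (integrableZl measurableT 2 intI)
    (integrableZl measurableT (2 * e ^+ 2) (intc' u^-1))).
have v0 : 0 < u `^ (- q) by exact: powR_gt0.
have v1 : u `^ (- q) <= 1.
  by rewrite -(powRr0 u) ler_powR//; lra.
have uE : `|u^-1| `^ q = u `^ (- q).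
  by rewrite gtr0_norm ?invr_gt0// -powR_inv1 ?(ltW u0)// -powRrM mulN1r.
have sE : `|s| `^ q = e `^ q * u `^ (- q).
  by rewrite normrM powRM// uE gtr0_norm.
have eq0 : 0 < e `^ q by exact: powR_gt0.
have eq1 : e `^ q <= 1.
  by rewrite -[leRHS](one_powR q) ge0_ler_powR ?nnegrE ?(ltW e0) ?(ltW q0).
rewrite -(fineK (fin_num_measure P A mA)) lee_fin /stable_tail_const -/e.
move: key; rewrite uE sE e2.
move: (u `^ (- q)) (e `^ q) (fine (P A)) v0 v1 eq0 eq1 => v E p v0 v1 E0 E1.
have /andP[_ h1] : v / 2 / 2 <= 1 - expR (- (v / 2)) <= v / 2.
  by apply: one_sub_expRN_bounds; lra.
have /andP[h2 _] : E * v / 2 / 2 <= 1 - expR (- (E * v / 2)) <= E * v / 2.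
  by apply: one_sub_expRN_bounds; nra.
move=> key; have : E * (1 - expR (- (v / 2))) <= E * (v / 2) by rewrite ler_pM2l.
move: key h2; clear; lra.
Qed.

End StableTail.

(** * Measurability and union bound *)

Section FiniteFamilies.
Context {d : measure_display} {T : measurableType d} {R : realType}.

Lemma measurable_forall_fin (I : finType) (F : I -> set T) :
  (forall i, measurable (F i)) -> measurable [set w | forall i, F i w].
Proof.
move=> mF; rewrite (_ : mkset _ = \big[setI/setT]_(i : I) F i).
  exact: bigsetI_measurable.
rewrite -bigcap_seq; apply/seteqP; split => w /= h i; first by move=> _; exact: h.
by apply: h; rewrite /= mem_index_enum.
Qed.

Lemma measurable_exists_fin (I : finType) (F : I -> set T) :
  (forall i, measurable (F i)) -> measurable [set w | exists i, F i w].
Proof.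
move=> mF; rewrite (_ : mkset _ = ~` [set w | forall i, (~` F i) w]).
  by apply/measurableC/measurable_forall_fin => i; exact: measurableC.
apply/seteqP; split => w /=; first by move=> [i Fi] /(_ i).
by move=> /existsNP[i /contrapT]; exists i.
Qed.

Lemma measurable_forall_count (I : countType) (F : I -> set T) :
  (forall i, measurable (F i)) -> measurable [set w | forall i, F i w].
Proof.
move=> mF; pose G k := if unpickle k is Some i then F i else setT.
rewrite (_ : mkset _ = \bigcap_k G k).
  by apply: bigcapT_measurable => k; rewrite /G; case: unpickle.
apply/seteqP; split => w /= h.
  by move=> k _; rewrite /G; case: unpickle.
by move=> i; have := h (pickle i) Logic.I; rewrite /G pickleK.
Qed.

Lemma measurable_ltr_set (f g : T -> R) : measurable_fun [set: T] f ->
  measurable_fun [set: T] g -> measurable [set w | f w < g w].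
Proof.
move=> mf mg; have /(_ measurableT [set true]) := measurable_fun_ltr mf mg.
by rewrite setTI; exact.
Qed.

Lemma union_bound (P : probability T R) (I : finType) (pr : pred I)
    (F : I -> set T) (A : set T) (K : R) : measurable A ->
  (forall i, pr i -> measurable (F i)) ->
  (forall w, A w -> exists2 i, pr i & F i w) ->
  (forall i, pr i -> (P (F i) <= K%:E)%E) -> (P A <= (\sum_(i | pr i) K)%:E)%E.
Proof.
move=> mA mF AF PK.
apply: (@le_trans _ _ (P (\big[setU/set0]_(i | pr i) F i))).
  apply: le_measure; rewrite ?inE//; first exact: bigsetU_measurable.
  move=> w /AF[i pri Fi]; rewrite -bigcup_seq_cond; exists i => //=.
  by rewrite mem_index_enum.
rewrite -sumEFin; elim: (index_enum I) => [|i r IH].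
  by rewrite !big_nil measure0.
rewrite !big_cons; case: ifPn => // pri.
apply: le_trans (measureU2 _ _ _) _; [exact: mF|exact: bigsetU_measurable|].
by rewrite leeD// PK.
Qed.

End FiniteFamilies.

Section MeasurableMatrices.
Context {d : measure_display} {T : measurableType d} {R : realType}.

Definition measurable_mx {m n} (F : T -> 'M[R]_(m, n)) :=
  forall i j, measurable_fun [set: T] (fun w => F w i j).

Lemma measurable_mx_cst {m n} (A : 'M[R]_(m, n)) : measurable_mx (fun=> A).
Proof. by move=> i j; exact: measurable_cst. Qed.

Lemma measurable_mx_tr {m n} (F : T -> 'M[R]_(m, n)) :
  measurable_mx F -> measurable_mx (fun w => (F w)^T).
Proof. by move=> mF i j; under eq_fun do rewrite mxE; exact: mF. Qed.

Lemma measurable_mx_mul {m n p} (F : T -> 'M[R]_(m, n)) (G : T -> 'M[R]_(n, p)) :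
  measurable_mx F -> measurable_mx G -> measurable_mx (fun w => F w *m G w).
Proof.
move=> mF mG i j; under eq_fun do rewrite mxE.
by apply: measurable_sum => k; apply: measurable_funM; [exact: mF|exact: mG].
Qed.

Lemma measurable_mx_det {n} (F : T -> 'M[R]_n) :
  measurable_mx F -> measurable_fun [set: T] (fun w => \det (F w)).
Proof.
move=> mF; apply: measurable_sum => s.
apply: measurable_funM; first exact: measurable_cst.
by apply: measurable_prod => i _; exact: mF.
Qed.

Lemma measurable_mx_adj {n} (F : T -> 'M[R]_n) :
  measurable_mx F -> measurable_mx (fun w => \adj (F w)).
Proof.
move=> mF i j; under eq_fun do rewrite mxE /cofactor.
apply: measurable_funM; first exact: measurable_cst.
apply: measurable_mx_det => k l; under eq_fun do rewrite !mxE; exact: mF.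
Qed.

Lemma measurable_dotp {n} (F G : T -> 'rV[R]_n) :
  measurable_mx F -> measurable_mx G ->
  measurable_fun [set: T] (fun w => dotp (F w) (G w)).
Proof.
move=> mF mG; apply: measurable_sum => i.
by apply: measurable_funM; [exact: mF|exact: mG].
Qed.

Lemma measurable_lnorm {n} (q : R) (F : T -> 'rV[R]_n) :
  measurable_mx F -> measurable_fun [set: T] (fun w => lnorm q%:E (F w)).
Proof.
move=> mF; apply: (measurableT_comp (measurable_powR _)).
apply: measurable_sum => i; apply: (measurableT_comp (measurable_powR _)).
by apply: measurableT_comp => //; exact: mF.
Qed.

Lemma measurable_vertex_of {N n} (eta : R) (S Q : {set 'I_(N + n)})
    (v : T -> 'I_N -> 'rV[R]_n) :
  (forall j, measurable_mx (fun w => v w j)) ->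
  measurable_mx (fun w => vertex_of eta S Q (v w)).
Proof.
move=> mv; apply: measurable_mx_tr.
have mA : measurable_mx
    (fun w => maskmx S (col_mx (\matrix_j v w j) eta%:M : 'M[R]_(N + n, n))).
  move=> j i; under eq_fun do rewrite !mxE.
  case: (j \in S); last exact: measurable_cst.
  case: (fintype.split j) => k; under eq_fun do rewrite mxE.
    exact: mv.
  exact: measurable_cst.
have mAt := measurable_mx_tr mA.
apply: measurable_mx_mul; first exact/measurable_mx_adj/measurable_mx_mul.
by apply: measurable_mx_mul => //; exact: measurable_mx_cst.
Qed.

End MeasurableMatrices.

Lemma measurable_row_of_tuple {R : realType} {n : nat} :
  measurable_mx (@row_of_tuple R n).
Proof.
move=> i j; under eq_fun do rewrite mxE.
exact: measurable_tnth.
Qed.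

(** * Probability of missing a vertex *)

Section MissProbability.
Context {d : measure_display} {T : measurableType d} {R : realType}.
Variable P : probability T R.
Variables (q r : R) (n : nat).
Hypotheses (q12 : 1 <= q < 2) (r1 : 1 <= r).

Local Notation p := (stable_tail_const q * r `^ (- q)).

Definition miss_set (y : 'rV[R]_n) : set (n.-tuple R) :=
  [set t | `|dotp (row_of_tuple t) y| < r * lnorm q%:E y].

Lemma measurable_miss_set y : measurable (miss_set y).
Proof.
apply: measurable_ltr_set; last exact: measurable_cst.
apply: measurableT_comp => //; apply: measurable_dotp.
  exact: measurable_row_of_tuple.
exact: measurable_mx_cst.
Qed.

Let q0 : 0 < q. Proof. by case/andP: q12 => q1 _; exact: lt_le_trans q1. Qed.

Lemma stable_tail_prob_le1 : p <= 1.
Proof.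
case/andP: q12 => q1 q2.
have e1 : (8^-1 : R) `^ (2 - q)^-1 <= 1.
  rewrite -[leRHS](one_powR (2 - q)^-1) ge0_ler_powR ?nnegrE//; last by lra.
  by rewrite invr_ge0; lra.
have e2 : ((8^-1 : R) `^ (2 - q)^-1) `^ q <= 1.
  by rewrite -[leRHS](one_powR q) ge0_ler_powR ?nnegrE ?powR_ge0// ltW.
have r2 : r `^ (- q) <= 1 by rewrite -(powRr0 r) ler_powR//; lra.
apply: mulr_ile1 => //; rewrite ?powR_ge0 ?(ltW (stable_tail_const_gt0 q))//.
by rewrite /stable_tail_const; lra.
Qed.

Variables (xi : {mfun T >-> R}) (xs : 'I_n -> {mfun T >-> R}).
Hypotheses (sxi : standard_stable P q xi) (ixs : independent_copies P xi xs).

Lemma random_vector_miss (y : 'rV[R]_n) :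
  (P (random_vector xs @^-1` miss_set y) <= (1 - p)%:E)%E.
Proof.
(* Degenerate pairs (S, Q) may produce the zero direction; the strict inequality makes its miss
   event empty. *)
have [y0|y0] := eqVneq y 0.
  rewrite (_ : _ @^-1` _ = set0).
    by rewrite measure0 lee_fin subr_ge0 stable_tail_prob_le1.
  apply/seteqP; split => // w /=.
  by rewrite /miss_set/= y0 lnorm0// mulr0 normr_lt0.
have s0 : 0 < lnorm q%:E y.
  by rewrite lt_def lnorm_ge0 andbT; apply: contra_neq y0; exact: lnorm_eq0.
set s := lnorm q%:E y in s0 *.
pose Y w := s^-1 * dotp (row_of_tuple (random_vector xs w)) y.
have mY : measurable_fun [set: T] Y.
  apply: measurable_funM; first exact: measurable_cst.
  apply: measurable_dotp; last exact: measurable_mx_cst.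
  move=> i j; under eq_fun do rewrite mxE tnth_mktuple.
  exact: measurable_funPT.
have cY t : \int[P]_w cos (t * Y w) = expR (- (`|t| `^ q / 2)).
  under eq_Rintegral do rewrite /Y mulrA.
  rewrite (@stable_linear_form _ _ _ P q n xi xs y (t / s) q0 sxi ixs) -/s.
  have s0' : 0 < s^-1 by rewrite invr_gt0.
  rewrite -(powRM _ (normr_ge0 _) (ltW s0)) normrM (gtr0_norm s0').
  by rewrite (mulfVK (lt0r_neq0 s0)).
have h := stable_tail q12 mY cY r1.
set A := [set w | _] in h.
have mA : measurable A.
  by apply: measurable_ltr_set; [exact: measurable_cst|exact: measurableT_comp].
apply: (@le_trans _ _ (P (~` A))).
  apply: le_measure; rewrite ?inE; last 1 first.
  - move=> w /=; rewrite /miss_set /A /Y/= -/s => hw.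
    apply/negP; rewrite -leNgt normrM gtr0_norm ?invr_gt0// mulrC.
    by rewrite ler_pdivrMr// ltW.
  - by apply: measurable_funPTI; exact: measurable_miss_set.
  - exact: measurableC.
by rewrite probability_setC// EFinB leeB.
Qed.

Variables (N : nat) (Xs : 'I_N -> {mfun T >-> n.-tuple R}).
Hypothesis iXs : independent_copies P (random_vector xs) Xs.

Lemma sample_miss j y : (P (Xs j @^-1` miss_set y) <= (1 - p)%:E)%E.
Proof.
have := iXs.2 j (miss_set y) (measurable_miss_set y).
by rewrite /distribution /pushforward => ->; exact: random_vector_miss.
Qed.

Variable eta : R.

Definition tuple_vertex (S Q : {set 'I_(N + n)}) (t : N.-tuple (n.-tuple R)) :=
  vertex_of eta S Q (fun j => row_of_tuple (tnth t j)).

Definition sample_part (S : {set 'I_(N + n)}) : {set 'I_N} :=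
  [set j | lshift n j \in S]%SET.

(** The component z.1 carries the rows that determine the candidate, z.2 the rows tested against it.
    Active rows are left out, as the candidate depends on them. *)
Definition vertex_event (S Q : {set 'I_(N + n)}) :
    set (N.-tuple (n.-tuple R) * N.-tuple (n.-tuple R)) :=
  [set z | forall j, (j \in ~: sample_part S)%SET ->
    miss_set (tuple_vertex S Q z.1) (tnth z.2 j)].

Lemma measurable_vertex_event S Q : measurable (vertex_event S Q).
Proof.
rewrite (_ : vertex_event S Q = [set z | forall j : 'I_N,
  (if (j \in ~: sample_part S)%SET
   then [set z | miss_set (tuple_vertex S Q z.1) (tnth z.2 j)] else setT) z]);
  last first.
  apply/seteqP; split => z /= h j; first by case: ifP => // /h.
  by move=> jS; have := h j; rewrite jS.
apply: measurable_forall_fin => j; case: ifP => _ //.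
have mt (k : 'I_N) (b : 'I_n)
    (f : N.-tuple (n.-tuple R) * N.-tuple (n.-tuple R) -> N.-tuple (n.-tuple R)) :
    measurable_fun setT f ->
    measurable_fun setT (fun z => tnth (tnth (f z) k) b).
  move=> mf; apply: (measurableT_comp (measurable_tnth b)).
  exact: (measurableT_comp (measurable_tnth k) mf).
have mv : measurable_mx
  (fun z : N.-tuple (n.-tuple R) * N.-tuple (n.-tuple R) => tuple_vertex S Q z.1).
  apply: measurable_vertex_of => k a b; under eq_fun do rewrite mxE.
  exact: mt.
apply: measurable_ltr_set.
  apply: measurableT_comp => //; apply: measurable_dotp => //.
  move=> a b; under eq_fun do rewrite mxE.
  exact: mt.
by apply: measurable_funM; [exact: measurable_cst|exact: measurable_lnorm].
Qed.

Definition zero_tuple : n.-tuple R := [tuple 0 | i < n].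

Lemma card_sample_part (S : {set 'I_(N + n)}) :
  (#|S| <= n)%N -> (N - n <= #|~: sample_part S|)%N.
Proof.
move=> Sn; rewrite cardsCs finset.setCK card_ord leq_sub2l//.
apply: leq_trans Sn; rewrite -(card_imset _ (@lshift_inj N n)).
by apply/subset_leq_card/fintype.subsetP => _ /imsetP[j + ->]; rewrite inE.
Qed.

(* Conditionally on the rows in S the vertex is fixed, and the remaining
   rows miss it independently. *)
Lemma vertex_event_prob (S Q : {set 'I_(N + n)}) : (#|S| <= n)%N ->
  (P (block_pair zero_tuple Xs (sample_part S) @^-1` vertex_event S Q)
     <= ((1 - p) ^+ (N - n))%:E)%E.
Proof.
move=> Sn; have p1 : 0 <= 1 - p by rewrite subr_ge0 stable_tail_prob_le1.
have p0 : 0 <= p by rewrite mulr_ge0 ?powR_ge0// ltW// stable_tail_const_gt0.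
have mE := measurable_vertex_event S Q.
set S0 := sample_part S.
have := @block_joint_law _ _ _ P _ _ zero_tuple N Xs iXs.1 S0 _ mE.
rewrite {1}/distribution /pushforward => ->; rewrite /product_measure1.
set mu := distribution P (block zero_tuple Xs S0).
set nu := distribution P (block zero_tuple Xs (~: S0)%SET).
apply: (@le_trans _ _ (\int[mu]_x cst ((1 - p) ^+ (N - n))%:E x)%E); last first.
  rewrite integral_cst// [X in (_ * X)%E](_ : _ = 1%E) ?mule1//.
  exact: (probability_setT mu).
apply: ge0_le_integral => //; first exact: measurable_fun_xsection.
move=> t _ /=.
have -> : nu (xsection (vertex_event S Q) t) = P (\bigcap_(j in [set` (~: S0)%SET])
    (Xs j @^-1` miss_set (tuple_vertex S Q t))).
  rewrite /nu /distribution /pushforward; congr (P _).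
  apply/seteqP; split => w /=.
    rewrite /xsection/= => /set_mem/= h j /= jS.
    by have := h j jS; rewrite /= tnth_mktuple jS.
  move=> h; apply/mem_set => j jS /=.
  by rewrite tnth_mktuple jS; exact: h.
rewrite iXs.1 => [|j _]; last exact: measurable_miss_set.
apply: (@le_trans _ _ (\prod_(j in (~: S0)%SET) (1 - p)%:E)%E).
  pose f j := fine (P (Xs j @^-1` miss_set (tuple_vertex S Q t))).
  have fE j : P (Xs j @^-1` miss_set (tuple_vertex S Q t)) = (f j)%:E.
    rewrite fineK// fin_num_measure//; apply: measurable_funPTI.
    exact: measurable_miss_set.
  under eq_bigr do rewrite fE.
  rewrite !prodEFin lee_fin; apply: ler_prod => j _.
  by rewrite fine_ge0//= -lee_fin -fE sample_miss.
rewrite prodEFin prodr_const lee_fin.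
(* At least N - n rows are free; surplus factors are at most 1. *)
rewrite -(subnK (card_sample_part Sn)) exprD ler_piMl ?exprn_ge0//.
by rewrite exprn_ile1// lerBlDr lerDl.
Qed.

End MissProbability.

(** * Number of active sets with signs, and the resulting numerics *)

Section Counting.
Context {R : realType}.

Definition signed_subset {M} (n : nat) (s : {set 'I_M} * {set 'I_M}) : bool :=
  (#|s.1| <= n)%N && (s.2 \subset s.1).

Lemma sum_expr_card (M : nat) (y : R) :
  \sum_(S : {set 'I_M}) y ^+ #|S| = (1 + y) ^+ M.
Proof.
transitivity (\prod_(i < M) (y + 1)); last by rewrite prodr_const card_ord addrC.
rewrite bigA_distr; apply: eq_bigr => S _.
by rewrite -prodr_const big_mkcond.
Qed.

(** As x <= 1, x^n is at most x^#|S| when #|S| <= n. With 2^#|S| choices of Q for each S, the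
    weighted count is dominated by the full binomial sum of (2x)^#|S|. *)
Lemma signed_subset_count (M n : nat) (x : R) : 0 < x <= 1 ->
  x ^+ n * \sum_(s : {set 'I_M} * {set 'I_M} | signed_subset n s) 1 <=
  (1 + 2 * x) ^+ M.
Proof.
move=> /andP[x0 x1].
rewrite -(pair_big_dep (fun S : {set 'I_M} => (#|S| <= n)%N)
  (fun (S Q : {set 'I_M}) => Q \subset S) (fun _ _ => 1 : R))/=.
rewrite mulr_sumr -sum_expr_card.
rewrite [leRHS](bigID (fun S : {set 'I_M} => (#|S| <= n)%N))/= ler_wpDr//.
  by apply: sumr_ge0 => S _; rewrite exprn_ge0// mulr_ge0// ltW.
apply: ler_sum => S Sn.
have -> : \sum_(Q : {set 'I_M} | Q \subset S) (1 : R) = 2 ^+ #|S|.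
  rewrite -natrX -card_powerset -sum1_card natr_sum; apply: eq_bigl => Q.
  by rewrite powersetE.
rewrite exprMn mulrC ler_pM2l ?exprn_gt0//.
by rewrite -(subnK Sn) exprD ler_piMl ?exprn_ge0 ?(ltW x0)// exprn_ile1// ltW.
Qed.

(** With X = N/n, b = 1 - alpha and z = X^(b/2), the target exponent is n z^2. The count is at most
    exp(n (3 + 2z/b)), hence at most exp(n z^2) once z >= 3 + 2/b, which is the power condition on
    N/n. *)
Lemma signed_subset_numerics (n N : nat) (alpha p : R) : (0 < n)%N ->
  0 < alpha < 1 -> 0 <= p <= 1 -> 2 * n%:R <= N%:R :> R ->
  (3 + 2 / (1 - alpha)) `^ (2 / (1 - alpha)) * n%:R <= N%:R ->
  4 * (N%:R / n%:R) `^ (- alpha) <= p ->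
  \sum_(s : {set 'I_(N + n)} * {set 'I_(N + n)} | signed_subset n s)
     (1 - p) ^+ (N - n) <=
  expR (- (N%:R `^ (1 - alpha) * n%:R `^ alpha)).
Proof.
move=> n0 /andP[a0 a1] /andP[p0 p1] nN zN pX.
set b := 1 - alpha in zN *; have b0 : 0 < b by rewrite subr_gt0.
have n0' : 0 < n%:R :> R by rewrite ltr0n.
set X : R := N%:R / n%:R in pX *.
have NX : N%:R = X * n%:R :> R by rewrite mulfVK// gt_eqF.
have X2 : 2 <= X by rewrite ler_pdivlMr.
have X0 : 0 < X by lra.
have zX : (3 + 2 / b) `^ (2 / b) <= X by rewrite ler_pdivlMr.
set z := X `^ (b / 2).
have b2 : 0 < 2 / b by rewrite divr_gt0.
have Xz : X = z `^ (2 / b).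
  rewrite /z -powRrM (_ : b / 2 * (2 / b) = 1) ?powRr1 ?(ltW X0)//.
  by field; rewrite gt_eqF.
have Xb : X `^ b = z ^+ 2.
  by rewrite /z -powR_mulrn ?powR_ge0// -powRrM mulfVK.
have z3 : 3 + 2 / b <= z.
  have -> : 3 + 2 / b = ((3 + 2 / b) `^ (2 / b)) `^ (b / 2).
    rewrite -powRrM (_ : 2 / b * (b / 2) = 1) ?powRr1//; first by lra.
    by field; rewrite gt_eqF.
  by rewrite ge0_ler_powR ?nnegrE ?powR_ge0 ?divr_ge0 ?(ltW b0) ?(ltW X0).
have NbX : N%:R `^ b * n%:R `^ alpha = n%:R * z ^+ 2.
  rewrite NX powRM ?(ltW X0) ?(ltW n0')// Xb -mulrA -powRD; last first.
    by rewrite (gt_eqF n0') implybT.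
  by rewrite subrK powRr1 ?(ltW n0')// mulrC.
rewrite NbX.
have XE : X `^ (- alpha) * X = z ^+ 2.
  rewrite -[in X in _ * X](powRr1 (ltW X0)) -powRD; last first.
    by rewrite (gt_eqF X0) implybT.
  by rewrite addrC Xb.
have Mn0 : 0 < (N + n)%:R :> R by rewrite natrD ltr_wpDl.
have count : \sum_(s : {set 'I_(N + n)} * {set 'I_(N + n)} | signed_subset n s)
    (1 : R) <= expR (n%:R * z ^+ 2).
  (* This weight makes (1 + 2x)^(N + n) at most exp(2n), so the count is at most x^-n exp(2n). *)
  pose x : R := n%:R / (N + n)%:R.
  have x0 : 0 < x by rewrite divr_gt0.
  have x1 : x <= 1 by rewrite ler_pdivrMr// mul1r ler_nat leq_addl.
  have := @signed_subset_count (N + n) n x; rewrite x0 x1 => /(_ isT) h.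
  have xn : 0 < x ^+ n by rewrite exprn_gt0.
  rewrite -(ler_pM2l xn); apply: le_trans h _.
  have e1 : (1 + 2 * x) ^+ (N + n) <= expR (2 * n%:R).
    apply: (@le_trans _ _ (expR (2 * x) ^+ (N + n))).
      by rewrite lerXn2r ?nnegrE ?expR_ge0 ?expR_ge1Dx//; lra.
    by rewrite -expRM_natl mulrCA [_ * x]mulrC /x mulfVK// gt_eqF.
  apply: le_trans e1 _.
  have e2 : 1 <= x * expR (1 + z * (2 / b)).
    (* z <= exp z turns the power X = z^(2/b) into an exponential that is linear in z in its
       exponent. *)
    have Xe : X <= expR (z * (2 / b)).
      rewrite expRM {1}Xz ge0_ler_powR ?nnegrE ?(ltW b2) ?powR_ge0 ?expR_ge0//.
      by have := expR_ge1Dx z; lra.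
    have e2 : 2 <= expR 1 :> R by have := @expR_ge1Dx R 1; lra.
    have xX : 1 <= x * (2 * X).
      rewrite /x mulrAC ler_pdivlMr// mul1r natrD NX; nra.
    apply: le_trans xX _; rewrite ler_pM2l// expRD.
    by apply: ler_pM => //; lra.
  have e3 : 1 <= x ^+ n * expR (n%:R * (1 + z * (2 / b))).
    by rewrite expRM_natl -exprMn exprn_ege1.
  apply: (@le_trans _ _
    (x ^+ n * expR (n%:R * (1 + z * (2 / b))) * expR (2 * n%:R))).
    by rewrite ler_peMl// expR_ge0.
  rewrite -mulrA -expRD ler_pM2l// ler_expR.
  rewrite (mulrC 2 n%:R) -mulrDr ler_pM2l//.
  have b2' := ltW b2; nra.
(* N - n >= N/2 and p >= 4 X^-alpha give p (N - n) >= 2 X^-alpha N = 2 n z^2. The factor 4 leaves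
   one n z^2 after the count is paid. *)
have pe : (1 - p) ^+ (N - n) <= expR (- (2 * (n%:R * z ^+ 2))).
  have h : 1 - p <= expR (- p) by have := expR_ge1Dx (- p); lra.
  apply: (@le_trans _ _ (expR (- p) ^+ (N - n))).
    by rewrite lerXn2r ?nnegrE ?expR_ge0//; lra.
  have nN' : (n <= N)%N by rewrite -(ler_nat R); lra.
  rewrite -expRM_natl ler_expR natrB// mulrN lerN2.
  have : 4 * X `^ (- alpha) * (N%:R - n%:R) <= p * (N%:R - n%:R).
    by rewrite ler_wpM2r//; lra.
  have : X `^ (- alpha) * N%:R = n%:R * z ^+ 2 by rewrite NX mulrA XE mulrC.
  have : 0 < X `^ (- alpha) by exact: powR_gt0.
  nra.
have -> : \sum_(s : {set 'I_(N + n)} * {set 'I_(N + n)} | signed_subset n s)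
    (1 - p) ^+ (N - n) = (\sum_(s : {set 'I_(N + n)} * {set 'I_(N + n)} |
      signed_subset n s) 1) * (1 - p) ^+ (N - n).
  by rewrite mulr_suml; apply: eq_bigr => s _; rewrite mul1r.
apply: (@le_trans _ _ (expR (n%:R * z ^+ 2) * expR (- (2 * (n%:R * z ^+ 2))))).
  apply: ler_pM => //; first exact: sumr_ge0.
  by rewrite exprn_ge0// subr_ge0.
by rewrite -expRD ler_expR; lra.
Qed.

End Counting.

(** * The inclusion *)

Section HullInclusion.
Context {d : measure_display} {T : measurableType d} {R : realType}.
Variable P : probability T R.

Lemma hull_inclusion_prob (q : R) (q' : \bar R) (r : R) (n N : nat)
    (xi : {mfun T >-> R}) (xs : 'I_n -> {mfun T >-> R})
    (Xs : 'I_N -> {mfun T >-> n.-tuple R}) :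
  (0 < N)%N -> 1 <= q < 2 -> (q%:E^-1 + q'^-1 = 1)%E -> 1 <= r ->
  standard_stable P q xi -> independent_copies P xi xs ->
  independent_copies P (random_vector xs) Xs ->
  let E := [set w : T | scale_set r (lball n q')
    `<=` absconv (fun j => row_of_tuple (Xs j w))] in
  measurable E /\
  (P (~` E) <= (\sum_(s : {set 'I_(N + n)} * {set 'I_(N + n)} | signed_subset n s)
    (1 - stable_tail_const q * r `^ (- q)) ^+ (N - n))%:E)%E.
Proof.
move=> N0 q12 qq' r1 sxi ixs iXs E.
have q1 : 1 <= q by case/andP: q12.
have r0 : 0 < r by exact: lt_le_trans r1.
have EP w : E w <-> forall y, exists j,
    r * lnorm q%:E y <= `|dotp (row_of_tuple (Xs j w)) y|.
  exact: (scale_lball_sub_absconvP _ N0 q1 qq' (ltW r0)).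
have mE : measurable E.
  rewrite (_ : E = [set w | forall y : 'rV[rat]_n, exists j,
      (~` (Xs j @^-1` miss_set q r (map_mx ratr y))) w]).
    apply: measurable_forall_count => y; apply: measurable_exists_fin => j.
    by apply/measurableC/measurable_funPTI; exact: measurable_miss_set.
  apply/seteqP; split => w.
    move=> /EP h y; have [j hj] := h (map_mx ratr y); exists j => /=.
    by apply/negP; rewrite -leNgt.
  move=> h; apply/EP/(all_rat_dualP _ N0 q1 qq' (ltW r0)) => y.
  by have [j /negP] := h y; rewrite -leNgt; exists j.
split => //.
pose F (s : {set 'I_(N + n)} * {set 'I_(N + n)}) : set T :=
  block_pair (@zero_tuple R n) Xs (sample_part s.1) @^-1`
    vertex_event q r (r / 2) s.1 s.2.
apply: (@union_bound _ _ _ P _ (@signed_subset (N + n) n) F).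
- exact: measurableC.
- move=> s _; apply: measurable_funPTI; exact: measurable_vertex_event.
- move=> w /EP/existsNP[y /forallNP hy].
  have {}hy j : `|dotp (row_of_tuple (Xs j w)) y| < r * lnorm q%:E y.
    by rewrite ltNge; apply/negP; exact: hy.
  have eta : 0 < r / 2 < r by apply/andP; split; lra.
  have [S [Q [Sn QS SQ]]] := missed_vertex N0 q1 qq' eta hy.
  exists (S, Q); first by rewrite /signed_subset Sn.
  move=> j jS; rewrite /miss_set /tuple_vertex.
  (* The masked block keeps the sample rows of S, the only ones the candidate sees. *)
  rewrite (_ : vertex_of _ _ _ _ =
      vertex_of (r / 2) S Q (fun j => row_of_tuple (Xs j w))); last first.
    by apply: vertex_of_local => k kS; rewrite tnth_mktuple inE kS.
  rewrite /mkset (_ : tnth _ j = Xs j w); first exact: SQ.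
  by rewrite tnth_mktuple jS.
- move=> [S Q] /andP[Sn _].
  exact: (vertex_event_prob q12 r1 sxi ixs iXs).
Qed.

End HullInclusion.

(** * Choice of the constants *)

Section Constants.
Context {R : realType}.

(* Makes the tail probability at radius stable_radius q * (N/n)^(alpha/q) at
   least 4 (n/N)^alpha. *)
Definition stable_radius (q : R) : R := (stable_tail_const q / 4) `^ q^-1.

(** One summand for each demand on N/n: 2 for N >= 2n, the middle one for the count of active sets,
    the last for a radius of at least 1, where the tail bound is valid. *)
Definition stable_ratio (alpha q : R) : R :=
  2 + (3 + 2 / (1 - alpha)) `^ (2 / (1 - alpha)) +
  (stable_radius q)^-1 `^ (q / alpha).

Lemma stable_radius_gt0 q : 0 < stable_radius q.
Proof. by rewrite powR_gt0// divr_gt0// stable_tail_const_gt0. Qed.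

Lemma absconv_stable_inclusion d (T : measurableType d) (P : probability T R)
    (q : R) (q' : \bar R) (alpha : R) (n N : nat) (xi : {RV P >-> R})
    (xs : 'I_n -> {RV P >-> R}) (Xs : 'I_N -> {RV P >-> n.-tuple R}) :
  1 <= q < 2 -> (q%:E^-1 + q'^-1 = 1)%E -> 0 < alpha < 1 -> (0 < n)%N ->
  stable_ratio alpha q * n%:R <= N%:R ->
  standard_stable P q xi -> independent_copies P xi xs ->
  independent_copies P (random_vector xs) Xs ->
  let E := [set w : T |
    scale_set (stable_radius q * (N%:R / n%:R) `^ (alpha / q)) (lball n q')
      `<=` absconv (fun j => row_of_tuple (Xs j w))] in
  measurable E /\
  ((1 - 2 * expR (- (1 * N%:R `^ (1 - alpha) * n%:R `^ alpha)))%:E <= P E)%E.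
Proof.
move=> q12 qq' a01 n0 cN sxi ixs iXs E.
have /andP[q1 q2] := q12; have /andP[a0 a1] := a01.
have q0 : 0 < q by exact: lt_le_trans q1.
have n0' : 0 < n%:R :> R by rewrite ltr0n.
set X : R := N%:R / n%:R in E *.
set c2 := stable_radius q in E *; have c20 : 0 < c2 by exact: stable_radius_gt0.
have k0 := stable_tail_const_gt0 q.
set A := (3 + 2 / (1 - alpha)) `^ (2 / (1 - alpha)).
have A0 : 0 <= A by exact: powR_ge0.
set B := c2^-1 `^ (q / alpha).
have B0 : 0 <= B by exact: powR_ge0.
have cN' : (2 + A + B) * n%:R <= N%:R by exact: cN.
have X2 : 2 + A + B <= X by rewrite ler_pdivlMr.
have X0 : 0 < X by lra.
set r := c2 * X `^ (alpha / q).
have r1 : 1 <= r.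
  rewrite -ler_pdivrMl// mulr1.
  have -> : c2^-1 = B `^ (alpha / q).
    rewrite /B -powRrM (_ : q / alpha * (alpha / q) = 1) ?powRr1 ?invr_ge0 ?ltW//.
    by field; rewrite !gt_eqF.
  by rewrite ge0_ler_powR ?nnegrE ?divr_ge0 ?(ltW a0) ?(ltW q0)//; lra.
have rE : stable_tail_const q * r `^ (- q) = 4 * X `^ (- alpha).
  rewrite /r powRM ?powR_ge0 ?(ltW c20)// -powRrM.
  rewrite (_ : alpha / q * - q = - alpha); last by field; rewrite gt_eqF.
  rewrite /c2 /stable_radius -powRrM mulrN mulVf ?gt_eqF// powR_inv1; last first.
    by rewrite divr_ge0// ltW.
  by rewrite mulrA invf_div mulrCA mulfV ?mulr1// gt_eqF.
have N0 : (0 < N)%N by rewrite -(ltr_nat R); nra.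
have [mE PE] := hull_inclusion_prob N0 q12 qq' r1 sxi ixs iXs.
split => //; have num : \sum_(s : {set 'I_(N + n)} * {set 'I_(N + n)} |
    signed_subset n s) (1 - stable_tail_const q * r `^ (- q)) ^+ (N - n) <=
    expR (- (N%:R `^ (1 - alpha) * n%:R `^ alpha)).
  apply: signed_subset_numerics => //.
  - by rewrite (stable_tail_prob_le1 q12 r1) mulr_ge0 ?powR_ge0// ltW.
  - by nra.
  - by rewrite -/A; nra.
  - by rewrite rE.
have e0 := expR_gt0 (- (N%:R `^ (1 - alpha) * n%:R `^ alpha)).
(* The union bound yields 1 - exp(-N^(1-alpha) n^alpha), which is at least the required bound. *)
rewrite mul1r -[E in P E]setCK probability_setC; last exact: measurableC.
rewrite EFinB leeB// (le_trans PE)// lee_fin (le_trans num)//.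
by rewrite ler_peMl// ?ltW//; lra.
Qed.

End Constants.

Theorem theorem1p8 (R : realType) :
  exists (c1 : R) (c0 : R -> R -> R) (c2 : R -> R) (c3 : R),
    [/\ 0 < c1,
        forall q : R, 1 <= q < 2 -> 0 < c2 q,
        0 < c3,
        forall (d : measure_display) (T : measurableType d)
               (P : probability T R) (q : R) (q' : \bar R) (alpha : R)
               (n N : nat) (xi : {RV P >-> R}) (xs : 'I_n -> {RV P >-> R})
               (Xs : 'I_N -> {RV P >-> n.-tuple R}),
          1 <= q < 2 ->
          (q%:E^-1 + q'^-1 = 1)%E ->
          0 < alpha < 1 ->
          (0 < n)%N ->
          c0 alpha q * n%:R <= N%:R ->
          standard_stable P q xi ->
          independent_copies P xi xs ->
          independent_copies P (random_vector xs) Xs ->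
          let E := [set w : T |
            scale_set (c2 q * (N%:R / n%:R) `^ (alpha / q)) (lball n q')
              `<=` absconv (fun j => row_of_tuple (Xs j w))] in
          measurable E /\
          ((1 - 2 * expR (- (c1 * N%:R `^ (1 - alpha) * n%:R `^ alpha)))%:E
             <= P E)%E
      & forall (d : measure_display) (T : measurableType d)
               (P : probability T R) (alpha : R)
               (n N : nat) (xi : {RV P >-> R}) (xs : 'I_n -> {RV P >-> R})
               (Xs : 'I_N -> {RV P >-> n.-tuple R}),
          0 < alpha < 1 ->
          (0 < n)%N ->
          c0 alpha 1 * n%:R <= N%:R ->
          standard_stable P 1 xi ->
          independent_copies P xi xs ->
          independent_copies P (random_vector xs) Xs ->
          let E := [set w : T |
            scale_set (c3 * (N%:R / n%:R) `^ alpha) (lball n +oo%E)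
              `<=` absconv (fun j => row_of_tuple (Xs j w))] in
          measurable E /\
          ((1 - 2 * expR (- (c1 * N%:R `^ (1 - alpha) * n%:R `^ alpha)))%:E
             <= P E)%E].
Proof.
exists 1, stable_ratio, stable_radius, (stable_radius 1); split => //.
- by move=> q _; exact: stable_radius_gt0.
- exact: stable_radius_gt0.
- exact: absconv_stable_inclusion.
move=> d T P alpha n N xi xs Xs a01 n0 cN sxi ixs iXs.
(* For q = 1 the conjugate exponent is +oo and alpha / q is alpha, so the radius constant at q = 1
   serves as the absolute constant. *)
have := @absconv_stable_inclusion R d T P 1 +oo%E alpha n N xi xs Xs.
rewrite divr1; apply => //; last by rewrite inve1 invey adde0.
by rewrite lexx ltr1n.
Qed.
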